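(* Let $Q$ be a quandle. The following are equivalent: (a) $Q$ is $4$-coherent; (b) colorings by $Q$ extend across $4$-moves: whenever two diagrams $D$ and $D'$ differ by a single $4$-move performed in a disk $B$, and $D,D'$ carry orientations agreeing outside $B$, every coloring of $D$ by $Q$ admits a coloring of $D'$ by $Q$ with the same colors outside $B$; (c) colorings by $Q$ extend across wink-moves: the same property as in (b) holds with ''$4$-move'' replaced by ''wink-move''. In particular, the wink-move induces the same relations on quandle colorings as the $4$-move.
   Context: **Diagrams.** A virtual diagram (or simply diagram) is the image of a proper smooth immersion of a $1$-manifold (a disjoint union of finitely many circles and intervals) into a disk, whose singularities are transverse double points, each labelled as a classical crossing (with over/under information) or a virtual crossing. Proper means that the boundary of the $1$-manifold is mapped to the boundary of the disk. **Quandles.** A quandle is a nonempty set $Q$ with two binary operations $\rhd,\rhd^{-1}:Q\times Q\to Q$ such that for all $x,y,z\in Q$: (1) $x\rhd x=x$; (2) $(x\rhd y)\rhd^{-1}y=x=(x\rhd^{-1}y)\rhd y$; (3) $(x\rhd y)\rhd z=(x\rhd z)\rhd(y\rhd z)$. It is $4$-coherent if moreover, for all $x,y\in Q$, (4) $(x\rhd y)\rhd x=(x\rhd y)\rhd^{-1}x=x\rhd^{-1}y$. **Colorings.** An arc of a diagram is a connected component of the diagram minus its crossings. A coloring of an oriented diagram by a quandle $Q$ assigns an element of $Q$ to each arc such that: at a virtual crossing, each of the two strands keeps its color; at a classical crossing, the over-strand keeps its color $y$, and if the under-arc lying on the right of the oriented over-strand has color $x$, then the under-arc lying on its left has color $x\rhd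 y$. **$4$-move.** The local move replacing two consecutive classical crossings of two strands (two half-twists of the same handedness, i.e. the two-strand braid $\sigma^2$) by the two opposite crossings (i.e. $\sigma^{-2}$). **Wink-move.** In a disk with boundary points TL, BL (left) and TR, BR (right), let $\ell$ be an arc joining TL to BL and bulging to the right, and $r$ an arc joining TR to BR and bulging to the left, so that $\ell$ and $r$ meet in exactly two points, an upper one and a lower one, bounding a bigon. One of these two points is a virtual crossing, and the other is a classical crossing at which $r$ passes over $\ell$ (two possibilities, according to whether the classical crossing is the upper or the lower one). Call this configuration $K$. Let $cK$ be the configuration obtained by inserting on the left of $K$ one classical crossing $c$ (of either of the two types) between the two left ends of $\ell$, so that $\ell$ acquires one self-crossing. The wink-moves are the local moves $cK \leftrightarrow K$ (up to planar isotopy and rotation). *)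

(* Defs.v *)
(* MathComp / MathComp-Analysis; the plane is R * R for a realType R. *)
From HB Require Import structures.
From mathcomp Require Import all_boot all_order all_algebra.
From mathcomp Require Import all_classical all_reals all_analysis.

Set Implicit Arguments.
Unset Strict Implicit.
Unset Printing Implicit Defensive.

Import Order.TTheory GRing.Theory Num.Theory.
Import numFieldNormedType.Exports.

Local Open Scope classical_set_scope.
Local Open Scope ring_scope.

Record quandle := Quandle {
  quandle_sort :> Type;
  qop : quandle_sort -> quandle_sort -> quandle_sort;
  qopV : quandle_sort -> quandle_sort -> quandle_sort;
  quandle_inhabited : inhabited quandle_sort;
  qop_idem : forall x, qop x x = x;
  qopK : forall x y, qopV (qop x y) y = x;
  qopVK : forall x y, qop (qopV x y) y = x;
  qop_dist : forall x y z, qop (qop x y) z = qop (qop x z) (qop y z)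
}.

Definition coherent4 (Q : quandle) : Prop :=
  forall x y : Q, qop (qop x y) x = qopV (qop x y) x /\
                  qopV (qop x y) x = qopV x y.

Section Plane.
Variable R : realType.

Definition plane : Type := (R * R)%type.

Definition unit_disk : set plane := [set p | p.1 ^+ 2 + p.2 ^+ 2 <= 1].
Definition unit_circle : set plane := [set p | p.1 ^+ 2 + p.2 ^+ 2 = 1].

Definition is_disk (B : set plane) : Prop :=
  exists f : plane -> plane,
    [/\ {within unit_disk, continuous f}, set_inj unit_disk f
      & B = f @` unit_disk].

(* [0 < det v w] iff [w] points to the left of [v]. *)
Definition det (v w : plane) : R := v.1 * w.2 - v.2 * w.1.

Definition smooth (f : R -> R) : Prop :=
  forall n t, derivable (derive1n n f) t 1.

Definition velocity (g : R -> plane) (t : R) : plane :=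
  (derive1 (fun u => (g u).1) t, derive1 (fun u => (g u).2) t).

(* A finite disjoint union of circles [R / Z] (the closed components) and of
   intervals [0, 1]; a point is a component with a real parameter, and the
   parameter of a point of a circle is defined up to an integer. *)
Record one_manifold := OneManifold {
  comp : finType;
  closed_comp : comp -> bool
}.

Section Manifold.
Variable M : one_manifold.

Definition in_dom (i : comp M) (t : R) : Prop :=
  closed_comp i \/ 0 <= t <= 1.

Definition inner_dom (i : comp M) (t : R) : Prop :=
  closed_comp i \/ 0 < t < 1.

Definition same_pt (i : comp M) (s : R) (j : comp M) (t : R) : Prop :=
  i = j /\ (s = t \/ (closed_comp i /\ exists k : int, s - t = k%:~R)).

Definition double_pt (g : comp M -> R -> plane)
    (i : comp M) (s : R) (j : comp M) (t : R) : Prop :=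
  [/\ in_dom i s, in_dom j t, ~ same_pt i s j t & g i s = g j t].

(* A diagram in the unit disk, oriented by its parametrization.
   - On an interval only the parameters in [0, 1] are meaningful: a smooth map
     on [0, 1] is the restriction of a smooth map on the line.
   - [virt p] says that the double point [p] is a virtual crossing; at a
     classical crossing, [over] selects the one of the two preimages that lies
     on the over-strand. Elsewhere the values of [virt] and [over] are
     irrelevant.
   - [diag_dbl_inner]: both branches run through a double point, so that it is
     not the image of an end of an interval. *)
Record diagram := Diagram {
  path : comp M -> R -> plane;
  virt : plane -> bool;
  over : comp M -> R -> bool;
  diag_periodic : forall i t, closed_comp i -> path i (t + 1) = path i t;
  diag_smooth : forall i,
    smooth (fun t => (path i t).1) /\ smooth (fun t => (path i t).2);
  diag_immersion : forall i t, in_dom i t -> velocity (path i) t <> (0, 0);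
  diag_in_disk : forall i t, in_dom i t -> unit_disk (path i t);
  diag_proper : forall i, ~~ closed_comp i ->
    unit_circle (path i 0) /\ unit_circle (path i 1);
  diag_dbl_inner : forall i s j t, double_pt path i s j t -> inner_dom i s;
  diag_transverse : forall i s j t, double_pt path i s j t ->
    det (velocity (path i) s) (velocity (path j) t) != 0;
  diag_no_triple : forall i s j t k u,
    double_pt path i s j t -> double_pt path i s k u -> same_pt j t k u;
  diag_over : forall i s j t, double_pt path i s j t ->
    ~~ virt (path i s) -> over i s = ~~ over j t
}.

Definition crossing (D : diagram) := double_pt (path D).

Definition support (D : diagram) : set plane :=
  [set p | exists i t, in_dom i t /\ path D i t = p].

Definition crossing_set (D : diagram) : set plane :=
  [set p | exists i s j t, crossing D i s j t /\ path D i s = p].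

(* The arcs of [D] are the connected components of this set. *)
Definition arcs (D : diagram) : set plane := support D `\` crossing_set D.

(* A coloring is given by the colors of the points of the arcs (its values
   elsewhere are irrelevant). At a classical crossing with over-strand [(i, s)],
   the sign of the determinant tells whether the under-strand [(j, t)] goes
   from right to left (+1) or from left to right (-1). *)
Definition coloring (Q : quandle) (D : diagram) (col : plane -> Q) : Prop :=
  [/\ forall p q, arcs D p -> connected_component (arcs D) p q ->
        col p = col q,
      forall i s j t, crossing D i s j t -> virt D (path D i s) ->
        \forall h \near (0 : R)^'+,
          col (path D i (s - h)) = col (path D i (s + h))
    & forall i s j t, crossing D i s j t -> ~~ virt D (path D i s) ->
        over D i s ->
        let e := Num.sg (det (velocity (path D i) s) (velocity (path D j) t)) in
        \forall h \near (0 : R)^'+,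
          col (path D i (s - h)) = col (path D i (s + h)) /\
          col (path D j (t + e * h)) =
            qop (col (path D j (t - e * h))) (col (path D i (s + h)))].

(* A parametrized piece of a component, traversed from the parameter [sfrom] to
   the parameter [sto]; if [sto < sfrom], it is traversed against the
   orientation of the diagram. *)
Record strand := Strand { scomp : comp M; sfrom : R; sto : R }.

Definition sparam (S : strand) (s : R) : R := sfrom S + s * (sto S - sfrom S).

Definition valid_strand (S : strand) : Prop :=
  if closed_comp (scomp S) then 0 < `|sto S - sfrom S| < 1 : Prop
  else [/\ sfrom S <> sto S, 0 <= sfrom S <= 1 & 0 <= sto S <= 1].

Definition on_strand (S : strand) (i : comp M) (t : R) : Prop :=
  exists2 s, 0 <= s <= 1 & same_pt i t (scomp S) (sparam S s).

Section Configurations.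
Variable D : diagram.

Definition spath (S : strand) (s : R) : plane := path D (scomp S) (sparam S s).

(* The velocity in the direction of traversal of the strand. *)
Definition svel (S : strand) (s : R) : plane :=
  let v := velocity (path D (scomp S)) (sparam S s) in
  ((sto S - sfrom S) * v.1, (sto S - sfrom S) * v.2).

Definition sdet (S : strand) (s : R) (S' : strand) (s' : R) : R :=
  det (svel S s) (svel S' s').

Definition svirt (S : strand) (s : R) : bool := virt D (spath S s).
Definition sover (S : strand) (s : R) : bool :=
  over D (scomp S) (sparam S s).

(* [D] meets [B] exactly in the two disjoint properly embedded strands
   [S1] and [S2]. *)
Definition two_strands_in (B : set plane) (S1 S2 : strand) : Prop :=
  [/\ valid_strand S1 /\ valid_strand S2,
      forall i t, ~ (on_strand S1 i t /\ on_strand S2 i t),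
      forall i t, in_dom i t ->
        (B (path D i t) <-> on_strand S1 i t \/ on_strand S2 i t),
      forall s, 0 <= s <= 1 -> (B° (spath S1 s) <-> 0 < s < 1)
    & forall s, 0 <= s <= 1 -> (B° (spath S2 s) <-> 0 < s < 1)].

Definition simple_strand (S : strand) : Prop :=
  forall s s', 0 <= s <= 1 -> 0 <= s' <= 1 -> spath S s = spath S s' -> s = s'.

Definition one_loop (S : strand) (c1 c2 : R) : Prop :=
  forall s s', 0 <= s -> s < s' -> s' <= 1 ->
    (spath S s = spath S s' <-> s = c1 /\ s' = c2).

Definition meet_twice (S1 S2 : strand) (s1 t1 s2 t2 : R) : Prop :=
  forall s t, 0 <= s <= 1 -> 0 <= t <= 1 ->
    (spath S1 s = spath S2 t <-> (s = s1 /\ t = t1) \/ (s = s2 /\ t = t2)).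

(* The handedness of a classical crossing of two strands, for their directions
   of traversal: positive if the under-strand crosses the over-strand from
   right to left. *)
Definition positive_half_twist (S : strand) (s : R) (S' : strand) (s' : R)
    : bool :=
  if sover S s then 0 < sdet S s S' s' else 0 < sdet S' s' S s.

(* The braid [sigma^2] (if [pos]) or [sigma^-2] (otherwise): both strands are
   traversed upwards, and [S1] is the one that starts on the left, so that it
   crosses [S2] from left to right and then from right to left. *)
Definition full_twist (S1 S2 : strand) (pos : bool) : Prop :=
  exists s1 s2 t1 t2 : R,
    [/\ [/\ 0 < s1, s1 < s2 & s2 < 1] /\ [/\ 0 < t1, t1 < t2 & t2 < 1],
        [/\ simple_strand S1, simple_strand S2
          & meet_twice S1 S2 s1 t1 s2 t2],
        0 < sdet S1 s1 S2 t1 /\ sdet S1 s2 S2 t2 < 0,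
        ~~ svirt S1 s1 /\ ~~ svirt S1 s2
      & positive_half_twist S1 s1 S2 t1 = pos /\
        positive_half_twist S1 s2 S2 t2 = pos].

(* The labels of [K] at its upper point (parameters [su] on [l] and [tu] on
   [r]) and at its lower point ([sl] and [tl]): [r] passes over [l] at the
   classical crossing, which is the upper one iff [up]. *)
Definition wink_labels (l r : strand) (up : bool) (su tu sl tl : R) : Prop :=
  if up then [/\ ~~ svirt l su, sover r tu & svirt l sl]
  else [/\ ~~ svirt l sl, sover r tl & svirt l su].

(* [K]: [l] is traversed from TL to BL, and [r] from TR to BR. As [l] bulges to
   the right and [r] to the left, both meet the upper point first; there [l]
   leaves to the left of [r] (in the sense of the direction of [r], i.e. to the
   east), and it comes back at the lower point. *)
Definition wink_K (l r : strand) (up : bool) : Prop :=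
  exists su sl tu tl : R,
    [/\ [/\ 0 < su, su < sl & sl < 1] /\ [/\ 0 < tu, tu < tl & tl < 1],
        [/\ simple_strand l, simple_strand r & meet_twice l r su tu sl tl],
        sdet l su r tu < 0 /\ 0 < sdet l sl r tl
      & wink_labels l r up su tu sl tl].

(* [cK]: coming from TL, [l] passes through the classical crossing [c], reaches
   the lower left end of [K], runs through [K] backwards (so that it meets the
   lower point first), and passes through [c] again on its way to BL. At [c] it
   first goes to the south-east and then to the south-west. The type of [c] is
   not prescribed. *)
Definition wink_cK (l r : strand) (up : bool) : Prop :=
  exists c1 sl su c2 tu tl : R,
    [/\ [/\ 0 < c1, c1 < sl, sl < su, su < c2 & c2 < 1] /\
          [/\ 0 < tu, tu < tl & tl < 1],
        [/\ one_loop l c1 c2, simple_strand r & meet_twice l r su tu sl tl],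
        sdet l c1 l c2 < 0 /\ ~~ svirt l c1,
        sdet l sl r tl < 0 /\ 0 < sdet l su r tu
      & wink_labels l r up su tu sl tl].

End Configurations.

(* [D] and [D'] are parametrized by the same manifold and coincide, with their
   orientations and labels, outside the interior of [B]. *)
Definition agree_outside (D D' : diagram) (B : set plane) : Prop :=
  (forall i t, in_dom i t -> ~ B° (path D i t) \/ ~ B° (path D' i t) ->
    path D i t = path D' i t) /\
  (forall i s j t, crossing D i s j t -> ~ B° (path D i s) ->
    virt D (path D i s) = virt D' (path D i s) /\
    (~~ virt D (path D i s) -> over D i s = over D' i s)).

(* [D'] is obtained from [D] by replacing, in the disk [B], two strands by two
   strands with the same ends. *)
Definition local_change (D D' : diagram) (B : set plane) (S1 S2 : strand)
    : Prop :=
  [/\ is_disk B /\ B `<=` unit_disk, agree_outside D D' B,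
      two_strands_in D B S1 S2 & two_strands_in D' B S1 S2].

(* The configurations below are invariant under isotopies and rotations of [B]:
   in a disk, the cyclic order of the ends of the strands is determined by
   their crossings. *)
Definition four_move (D D' : diagram) (B : set plane) : Prop :=
  exists S1 S2 pos,
    [/\ local_change D D' B S1 S2, full_twist D S1 S2 pos
      & full_twist D' S1 S2 (~~ pos)].

Definition wink_move (D D' : diagram) (B : set plane) : Prop :=
  exists l r up, local_change D D' B l r /\
    ((wink_cK D l r up /\ wink_K D' l r up) \/
     (wink_K D l r up /\ wink_cK D' l r up)).

End Manifold.

Definition colorings_extend (Q : quandle)
    (move : forall M : one_manifold,
      diagram M -> diagram M -> set plane -> Prop) : Prop :=
  forall (M : one_manifold) (D D' : diagram M) (B : set plane),
    move M D D' B ->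
    forall col : plane -> Q, coloring D col ->
    exists col' : plane -> Q, coloring D' col' /\
      forall p, arcs D p -> ~ B° p -> col' p = col p.

End Plane.

(* Main.v *)
(* In a disk that meets a diagram in two strands, a coloring amounts to one color
   for each interval between consecutive passages of a strand through crossings,
   subject to one equation per crossing. A coloring of the outside therefore
   extends over the disk iff the colors of the four ends satisfy the relation
   obtained by eliminating the inner colors. For [sigma^2] and [sigma^-2], and
   for [cK] and [K], these relations agree for all orientations when the quandle
   is 4-coherent. Conversely, applying a move to explicit polynomial diagrams that
   fill the unit disk makes the two relations agree, and their instances for the
   two orientations of one strand are the two identities of 4-coherence.

   A coloring is only assumed constant on connected components of the set of arcs.
   It is locally constant on this set, because crossings do not accumulate at a
   point of an arc: the manifold is compact and an immersion is locally
   injective. *)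

From mathcomp Require Import all_boot all_order all_algebra.
From mathcomp Require Import all_classical all_reals all_analysis.
From mathcomp Require Import ring lra.
Require Import Defs.

Set Implicit Arguments.
Unset Strict Implicit.
Unset Printing Implicit Defensive.

Import Order.TTheory GRing.Theory Num.Theory.
Import numFieldNormedType.Exports.

Local Open Scope classical_set_scope.
Local Open Scope ring_scope.

(** * Curves in the plane *)

(** Strands are traversed in the direction fixed by the configuration, whatever the orientation of
    the diagram. An orientation then enters only through a boolean that selects one of the two
    quandle operations ([act]), so that one computation per configuration covers all orientations.
    The delicate place for gluing is an end of a strand: it lies on the boundary of a disk that is
    only a continuous injective image of the unit disk, and local constancy has to be checked there
    both along the strand and outside the disk. For cK there are two cases. If l first passes over
    c, the relation gives the final color of l explicitly. If l first passes under c, this color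
    occurs on both sides of its equation, and 4-coherence is what solves it. The converse works with
    the explicit case: it passes from K to cK with l first over c, and from sigma^2 to sigma^-2. *)

Definition locally_constant_on (T : topologicalType) U (A : set T)
    (f : T -> U) : Prop :=
  forall p, A p -> \forall q \near p, A q -> f q = f p.

(** The points of the component where [f] takes the value [f p] form a nonempty relatively clopen
    subset, hence everything. *)
Lemma locally_constant_component (T : topologicalType) U (A : set T)
    (f : T -> U) p q :
  locally_constant_on A f -> connected_component A p q -> f q = f p.
Proof.
move=> lcf Cpq.
have Ap : A p by case: Cpq => C [Cp CA _] _; exact: CA.
pose B := [set q | connected_component A p q /\ f q = f p].
suff BE : B = connected_component A p by move: Cpq; rewrite -BE => -[].
apply: component_connected.
- by exists p; split => //; exact: connected_component_refl.
- exists ([set q | A q -> f q = f p]°); first exact: open_interior.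
  apply/seteqP; split => [x [Cx fx]|x [Cx /interior_subset fx]]; split => //.
    have /lcf : A x := connected_component_sub Cx.
    by rewrite fx.
  by apply: fx; exact: connected_component_sub Cx.
- exists (~` [set q | A q -> f q <> f p]°).
    exact/open_closedC/open_interior.
  apply/seteqP; split => [x [Cx fx]|x [Cx nfx]]; split => //.
    by move=> /interior_subset/(_ (connected_component_sub Cx)).
  apply: contrapT => fx; apply: nfx.
  have /lcf : A x := connected_component_sub Cx.
  by apply: filterS => y + Ay => ->.
Qed.

Section Curves.
Variable R : realType.

(** The part of [[0, 1]] outside [A i] is compact, so its image is closed, and this image misses
    [p]. *)
Lemma curves_near (I : finType) (g : I -> R -> plane R) (A : I -> set R) p :
  (forall i, continuous (g i)) -> (forall i, open (A i)) ->
  (forall i t, 0 <= t <= 1 -> g i t = p -> A i t) ->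
  \forall q \near p, forall i t, 0 <= t <= 1 -> g i t = q -> A i t.
Proof.
move=> gc Ao Ap.
apply: (@filter_forall _ I
  (fun i q => forall t, 0 <= t <= 1 -> g i t = q -> A i t) (nbhs p)) => i.
pose K := g i @` (`[0, 1] `\` A i).
have Kcl : closed K.
  apply: compact_closed; first exact: norm_hausdorff.
  apply: continuous_compact; first exact/continuous_subspaceT/gc.
  apply: (subclosed_compact _ (@segment_compact R 0 1)) => //.
  rewrite setDE; apply: closedI; first exact: interval_closed.
  exact/open_closedC/Ao.
have : nbhs p (~` K).
  apply: open_nbhs_nbhs; split; first exact: closed_openC.
  move=> [t [/= + nAt] gtp]; rewrite in_itv /= => t01.
  by apply: nAt; exact: Ap gtp.
apply: filterS => q nKq t t01 gtq; apply: contrapT => nAt; apply: nKq.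
by exists t => //; split => //=; rewrite in_itv.
Qed.

(** By Rolle, two equal values near [t] would give a zero of the derivative near [t]. *)
Lemma derive1_neq0_locally_injective (f : R -> R) t :
  (forall x, derivable f x 1) -> {for t, continuous (derive1 f)} ->
  derive1 f t != 0 ->
  \forall d \near (0 : R)^'+, forall a b, `|a - t| < d -> `|b - t| < d ->
    f a = f b -> a = b.
Proof.
move=> fd fc ft0.
have : \forall s \near t, derive1 f s != 0.
  exact: (@cvgr_neq0 R R R _ (nbhs_filter t) _ _ fc ft0).
move=> /nbhs_ballP[e /= e0 He]; near=> d.
have dlte : d < e by near: d; exact: nbhs_right_lt.
suff main a b : a < b -> `|a - t| < d -> `|b - t| < d -> f a <> f b.
  move=> a b ad bd fab; have [ab|ba|//] := ltgtP a b.
    by have := main _ _ ab ad bd.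
  by have := main _ _ ba bd ad; rewrite fab.
move=> ab ad bd fab.
have [|c cab fc0] := Rolle ab (fun x _ => fd x) _ fab.
  exact: derivable_within_continuous.
have /He : ball t e c.
  rewrite /ball /= distrC; apply: lt_trans dlte.
  move: cab ad bd; rewrite in_itv /= !ltr_norml => /andP[ac cb].
  by move=> /andP[? ?] /andP[? ?]; apply/andP; split; lra.
by rewrite derive1E derive_val eqxx.
Unshelve. all: by end_near. Qed.

Lemma smooth_derivable (f : R -> R) : smooth f -> forall x, derivable f x 1.
Proof. by move=> sf x; exact: (sf 0%N x). Qed.

Lemma smooth_continuous (f : R -> R) : smooth f -> continuous f.
Proof.
by move=> sf x; apply/differentiable_continuous/derivable1_diffP/smooth_derivable.
Qed.

Lemma smooth_continuous_derive1 (f : R -> R) :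
  smooth f -> continuous (derive1 f).
Proof.
move=> sf x; apply/differentiable_continuous/derivable1_diffP.
exact: (sf 1%N x).
Qed.

Lemma immersion_locally_injective (g : R -> plane R) t :
  smooth (fun u => (g u).1) -> smooth (fun u => (g u).2) ->
  velocity g t <> (0, 0) ->
  \forall d \near (0 : R)^'+, forall a b, `|a - t| < d -> `|b - t| < d ->
    g a = g b -> a = b.
Proof.
move=> s1 s2 vt0.
have [e1|n1] := eqVneq (derive1 (fun u => (g u).1) t) 0; last first.
  have := derive1_neq0_locally_injective (smooth_derivable s1)
    (@smooth_continuous_derive1 _ s1 t) n1.
  by apply: filterS => d inj a b ad bd gab; apply: inj => //; rewrite gab.
have [e2|n2] := eqVneq (derive1 (fun u => (g u).2) t) 0.
  by exfalso; apply: vt0; rewrite /velocity e1 e2.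
have := derive1_neq0_locally_injective (smooth_derivable s2)
  (@smooth_continuous_derive1 _ s2 t) n2.
by apply: filterS => d inj a b ad bd gab; apply: inj => //; rewrite gab.
Qed.

End Curves.

(** * Local structure of a diagram *)

Section DiagramGeometry.
Variables (R : realType) (M : one_manifold).

Lemma same_pt_refl (i : comp M) (s : R) : same_pt i s i s.
Proof. by split; [|left]. Qed.

Lemma same_pt_sym (i j : comp M) (s t : R) :
  same_pt i s j t -> same_pt j t i s.
Proof.
case=> ij [st|[ci [k st]]]; split => //; first by left.
by right; rewrite -ij; split => //; exists (- k); rewrite mulrNz -st opprB.
Qed.

Lemma same_pt_trans (i j k : comp M) (s t u : R) :
  same_pt i s j t -> same_pt j t k u -> same_pt i s k u.
Proof.
case=> <- [<- //|[ci [m st]]] [<- tu]; split => //; right; split => //.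
case: tu => [<-|[_ [n tu]]]; first by exists m.
by exists (m + n); rewrite mulrzDr -st -tu; ring.
Qed.

Lemma same_pt_add (i j : comp M) (s t h : R) :
  same_pt i s j t -> same_pt i (s + h) j (t + h).
Proof.
case=> ij [->|[ci [k st]]]; split => //; first by left.
by right; split => //; exists k; rewrite -st; ring.
Qed.

Lemma in_dom_same_pt (i j : comp M) (s t : R) :
  same_pt i s j t -> in_dom i s -> in_dom j t.
Proof. by case=> <- [<- //|[ci _]] _; left. Qed.

Lemma inner_in_dom (i : comp M) (s : R) : inner_dom i s -> in_dom i s.
Proof. by case=> [|/andP[s0 s1]]; [left|right; rewrite !ltW]. Qed.

Lemma inner_dom_near (i : comp M) (s : R) :
  inner_dom i s -> \forall t \near s, inner_dom i t.
Proof.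
case=> [ci|s01]; first by near=> t; left.
have : \forall t \near s, t \in `]0, 1[ by exact: near_in_itvoo.
by apply: filterS => t; rewrite in_itv /= => t01; right.
Unshelve. all: by end_near. Qed.

(** Brings the parameters of a circle into a compact interval, as [curves_near] requires. *)
Lemma same_pt01 (i : comp M) (s : R) :
  in_dom i s -> exists2 t, same_pt i s i t & 0 <= t <= 1.
Proof.
case=> [ci|s01]; last by exists s => //; exact: same_pt_refl.
exists (s - (Num.floor s)%:~R).
  split => //; right; split => //; exists (Num.floor s); ring.
have := ge_floor s; have := floorD1_gt s; rewrite intrD; lra.
Qed.

Variable D : diagram R M.

Lemma path_continuous i : continuous (path D i).
Proof.
move=> t; have [s1 s2] := diag_smooth D i.
have -> : path D i = (fun u => ((path D i u).1, (path D i u).2)).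
  by apply/funext => u; rewrite -surjective_pairing.
have c1 := @smooth_continuous _ _ s1 t; have c2 := @smooth_continuous _ _ s2 t.
exact: (@cvg_pair _ _ _ (nbhs t) _ _ _ _ _ _ _ c1 c2).
Qed.

Lemma path_period i (k : int) t :
  closed_comp i -> path D i (t + k%:~R) = path D i t.
Proof.
move=> ci; have nat_period n u : path D i (u + n%:R) = path D i u.
  elim: n => [|n IH]; first by rewrite addr0.
  by rewrite -natr1 addrA diag_periodic.
case: k => n; first exact: nat_period.
by have := nat_period n.+1 (t - n.+1%:R); rewrite subrK NegzE mulrNz => ->.
Qed.

Lemma path_same_pt i s j t : same_pt i s j t -> path D i s = path D j t.
Proof.
case=> <- [->//|[ci [k st]]].
by rewrite -(subrK t s) st addrC path_period.
Qed.

Lemma velocity_same_pt i s j t : same_pt i s j t ->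
  velocity (path D i) s = velocity (path D j) t.
Proof.
case=> <- [->//|[ci [k st]]].
have -> : s = t + k%:~R by rewrite -st; ring.
have shift (f : R -> R) : smooth f -> (forall u, f (u + k%:~R) = f u) ->
    derive1 f (t + k%:~R) = derive1 f t.
  move=> sf fk.
  have H1 : is_derive (t + k%:~R) (1 : R) f (derive1 f (t + k%:~R)).
    by rewrite derive1E; exact/derivableP/smooth_derivable.
  have H2 : is_derive t (1 : R) (fun u : R => u + k%:~R) 1.
    by rewrite -[X in is_derive _ _ _ X]addr0; exact: is_deriveD.
  have := @is_derive1_comp R f (fun u : R => u + k%:~R) t _ _ H1 H2.
  rewrite mulr1 (_ : f \o _ = f); last by apply/funext => u /=.
  by move=> H3; rewrite [RHS]derive1E derive_val.
have [s1 s2] := diag_smooth D i.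
by rewrite /velocity !shift // => u; rewrite path_period.
Qed.

Lemma crossing_sym i s j t : crossing D i s j t -> crossing D j t i s.
Proof. by case=> is_ jt n e; split => // /same_pt_sym. Qed.

Lemma crossing_same_pt i s i' s' j t :
  same_pt i s i' s' -> crossing D i s j t -> crossing D i' s' j t.
Proof.
move=> e [is_ jt n p]; split => //; first exact: in_dom_same_pt e is_.
  by move=> e'; apply: n; exact: same_pt_trans e e'.
by rewrite -p; apply/path_same_pt/same_pt_sym.
Qed.

Lemma over_same_pt i s i' s' j t : same_pt i s i' s' -> crossing D i s j t ->
  ~~ virt D (path D i s) -> over D i s = over D i' s'.
Proof.
move=> e x v; rewrite (diag_over x v) (diag_over (crossing_same_pt e x)) //.
by rewrite -(path_same_pt e).
Qed.

Lemma arcs_path i t : in_dom i t ->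
  arcs D (path D i t) <-> forall j u, ~ crossing D i t j u.
Proof.
move=> it; split => [[_ nx] j u x|nx]; first by apply: nx; exists i, t, j, u.
split; first by exists i, t.
move=> [i' [s [j [u [x e]]]]].
have [/same_pt_sym eq|neq] := pselect (same_pt i t i' s).
  by apply: (nx j u); exact: crossing_same_pt x.
by case: (x) => is_ _ _ _; apply: (nx i' s); split.
Qed.

(** A point of an arc has a single preimage, so compactness forces all preimages of nearby points to
    be close to it. *)
Lemma path_near i t d : in_dom i t -> arcs D (path D i t) -> 0 < d ->
  \forall q \near path D i t, forall j u, in_dom j u -> path D j u = q ->
    exists2 t', same_pt j u i t' & `|t' - t| < d.
Proof.
move=> it /(arcs_path it) nx d0.
pose A j := [set u : R | exists2 t', same_pt j u i t' & `|t' - t| < d].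
have Ao j : open (A j).
  rewrite openE => u [t' e td].
  apply/nbhs_ballP; exists (d - `|t' - t|) => /=; first by rewrite subr_gt0.
  move=> u'; rewrite /ball /= => uu'; exists (t' + (u' - u)).
    by rewrite -[X in same_pt _ X _ _](subrKC u u'); exact: same_pt_add.
  rewrite (_ : _ - t = (t' - t) + (u' - u)); last by ring.
  apply: le_lt_trans (ler_normD _ _) _.
  by rewrite -ltrBrDl distrC.
have Ap j u : 0 <= u <= 1 -> path D j u = path D i t -> A j u.
  move=> u01 e; exists t; last by rewrite subrr normr0.
  apply: contrapT => n; apply: (nx j u); split => //; first by right.
  by move=> /same_pt_sym.
have := curves_near path_continuous Ao Ap.
apply: filterS => q Hq j u ju e; have [u' eu u'01] := same_pt01 ju.
have [||t' e' t'd] := Hq j u' => //; first by rewrite -(path_same_pt eu).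
by exists t' => //; exact: same_pt_trans eu e'.
Qed.

(** Both preimages of a crossing close to the arc point would be close to [t] by [path_near],
    against local injectivity of the immersion. *)
Lemma arcs_near i t : in_dom i t -> arcs D (path D i t) ->
  \forall t' \near t, in_dom i t' -> arcs D (path D i t').
Proof.
move=> it At; have [s1 s2] := diag_smooth D i.
have inj := immersion_locally_injective s1 s2 (diag_immersion it).
have [d [d0 {}inj]] : exists d, 0 < d /\ forall a b, `|a - t| < d ->
    `|b - t| < d -> path D i a = path D i b -> a = b.
  near (0 : R)^'+ => d; exists d; split; first by near: d; exact: nbhs_right_gt.
  by near: d.
have H : \forall t' \near t, forall j u, in_dom j u ->
    path D j u = path D i t' -> exists2 u', same_pt j u i u' & `|u' - t| < d.
  exact: (@path_continuous i t _ (path_near it At d0)).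
have : \forall t' \near t, `|t' - t| < d.
  by apply/nbhs_ballP; exists d => //= t'; rewrite /ball /= distrC.
move: H; apply: filterS2 => t' H t'd it'.
apply/(arcs_path it') => j u [_ ju n e].
have [u' eu u'd] := H j u ju (esym e); apply: n.
have <- : u' = t' by apply: inj => //; rewrite -(path_same_pt eu).
exact: same_pt_sym.
Unshelve. all: by end_near. Qed.

Section ComponentConstant.
Variables (T : Type) (col : plane R -> T).
Hypothesis colC : forall p q, arcs D p ->
  connected_component (arcs D) p q -> col p = col q.

Lemma col_segment i a b : a <= b ->
  (forall t, a <= t <= b -> arcs D (path D i t)) ->
  col (path D i a) = col (path D i b).
Proof.
move=> ab H; apply: colC; first by apply: H; rewrite lexx.
apply: (@connected_component_max _ _ (path D i @` `[a, b])).
- by exists a => //=; rewrite in_itv /= lexx.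
- by move=> _ [t /= + <-]; rewrite in_itv /=; exact: H.
- apply: connected_continuous_connected; first exact: segment_connected.
  exact/continuous_subspaceT/path_continuous.
- by exists b => //=; rewrite in_itv /= lexx andbT.
Qed.

(** A nearby arc point has a parameter [t'] near [t], and the path between the two parameters stays
    in the arcs. *)
Lemma col_locally_constant : locally_constant_on (arcs D) col.
Proof.
move=> p Ap; case: (Ap) => -[i [t [it tp]]] _; subst p.
have /nbhs_ballP[d /= d0 Hd] := arcs_near it Ap.
have := path_near it Ap d0.
apply: filterS => q Hq [[j [u [ju e]]] _].
have [t' e' t'd] := Hq j u ju e; rewrite -e (path_same_pt e').
have it' := in_dom_same_pt e' ju.
have conv a : Num.min t t' <= a <= Num.max t t' -> arcs D (path D i a).
  move=> at_; apply: Hd.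
    rewrite /ball /= distrC; move: t'd at_; rewrite !ltr_norml.
    by case: (leP t t') => _ /andP[? ?] /andP[? ?]; apply/andP; split; lra.
  case: it it' => [ci|t01] [ci'|t'01]; try by left.
  by right; move: at_; case: (leP t t') => _; lra.
case: (leP t t') conv => tt' conv.
  exact/esym/col_segment.
by apply: col_segment; first exact: ltW.
Qed.

End ComponentConstant.

End DiagramGeometry.

(** * Crossings along two strands *)

(** Both operations under one name: the boolean will be computed from orientations and from the
    signs of crossings. *)
Definition act (Q : quandle) (b : bool) (x y : Q) : Q :=
  if b then qop x y else qopV x y.

Lemma actK (Q : quandle) b (x y : Q) : act b (act (~~ b) x y) y = x.
Proof. by case: b; [exact: qopVK|exact: qopK]. Qed.

Lemma actNK (Q : quandle) b (x y : Q) : act (~~ b) (act b x y) y = x.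
Proof. by case: b; [exact: qopK|exact: qopVK]. Qed.

Lemma act_eq_sym (Q : quandle) b (x y z : Q) :
  (x = act b y z) <-> (y = act (~~ b) x z).
Proof. by split => ->; [rewrite actNK|rewrite actK]. Qed.

Section NearRight.
Variable R : realType.

Lemma near_right0_scale (P : R -> Prop) (c : R) : 0 < c ->
  (\forall h \near (0 : R)^'+, P h) -> \forall h \near (0 : R)^'+, P (c * h).
Proof.
move=> c0 /nbhs_right0P; rewrite /= => H.
have [d /= d0 Hd] : exists2 d : R, 0 < d & forall h, 0 < h < d -> P h.
  have [d /= d0 Hd] := H; exists d => // h /andP[h0 hd].
  by have := Hd h; rewrite /= sub0r normrN gtr0_norm // add0r; exact.
exists (d / c) => /=; first by rewrite divr_gt0.
move=> h /=; rewrite sub0r normrN => hd h0; apply: Hd.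
by rewrite mulr_gt0 //= mulrC -ltr_pdivlMr // -(gtr0_norm h0).
Qed.

Lemma near_right0_seq (l : seq R) (P : R -> R -> Prop) :
  (forall u, u \in l -> \forall h \near (0 : R)^'+, P u h) ->
  \forall h \near (0 : R)^'+, forall u, u \in l -> P u h.
Proof.
elim: l => [|a l IH] H; first by near=> h.
have {}IH := IH (fun u ul => H u (mem_behead (s := a :: l) ul)).
have Ha := H a (mem_head _ _).
move: Ha IH; apply: filterS2 => h Ha IH u.
by rewrite inE => /predU1P[->//|/IH].
Unshelve. all: by end_near. Qed.

(** Turns a coloring rule, which is a statement about all small [h], into an equation between
    colors; the right filter at 0 is proper. *)
Lemma near_right0_iff (P : R -> Prop) (P0 : Prop) :
  (\forall h \near (0 : R)^'+, P h <-> P0) ->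
  ((\forall h \near (0 : R)^'+, P h) <-> P0).
Proof.
move=> H; split => [HP|p0]; last by move: H; apply: filterS => h ->.
near (0 : R)^'+ => h; have [PP _] : P h <-> P0 by near: h.
by apply: PP; near: h.
Unshelve. all: by end_near. Qed.

(** When [l] lists the crossing parameters of a strand, the rank numbers the intervals between them,
    and [l] need not be sorted. *)
Definition rank (l : seq R) (s : R) : nat := count (fun u => u < s) l.

Lemma rank_near (l : seq R) s : uniq l -> s \in l ->
  \forall h \near (0 : R)^'+,
    [/\ s - h \notin l, s + h \notin l, rank l (s - h) = rank l s
      & rank l (s + h) = (rank l s).+1].
Proof.
move=> ul sl.
have key : \forall h \near (0 : R)^'+, forall u, u \in l ->
    [/\ u != s - h, u != s + h, (u < s - h) = (u < s)
      & (u < s + h) = (u <= s)].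
  apply: near_right0_seq => u _; have [us|us|->] := ltgtP u s; near=> h;
    have h0 : 0 < h by near: h; exact: nbhs_right_gt.
  - have : h < s - u by near: h; apply: nbhs_right_lt; rewrite subr_gt0.
    by split; [apply/eqP; lra|apply/eqP; lra|apply/idP; lra|apply/idP; lra].
  - have : h < u - s by near: h; apply: nbhs_right_lt; rewrite subr_gt0.
    by split; [apply/eqP; lra|apply/eqP; lra|apply/negbTE; rewrite -leNgt; lra
      |apply/negbTE; rewrite -leNgt; lra].
  - by split; [apply/eqP; lra|apply/eqP; lra|apply/negbTE; rewrite -leNgt; lra
      |apply/idP; lra].
move: key; apply: filterS => h H; split.
- by apply/negP => /H[]; rewrite eqxx.
- by apply/negP => /H[]; rewrite eqxx.
- by apply: eq_in_count => u /H[].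
rewrite /rank -addn1 -[X in (_ + X)%N](_ : count_mem s l = 1%N); last first.
  by rewrite count_uniq_mem // sl.
rewrite -[LHS](@eq_in_count _ (predU (fun u => u < s) (pred1 s))).
  rewrite -count_predUI (_ : count (predI _ _) _ = 0%N) ?addn0 //.
  rewrite -[RHS](count_pred0 l); apply: eq_count => u /=.
  by apply/negP => /andP[us /eqP e]; move: us; rewrite e ltxx.
by move=> u /H[_ _ _ e] /=; rewrite e le_eqVlt orbC.
Unshelve. all: by end_near. Qed.

Lemma rank_eq_notin (l : seq R) s t u : rank l s = rank l t ->
  s \notin l -> t \notin l -> s <= u <= t -> u \notin l.
Proof.
move=> e sl tl /andP[su ut]; apply/negP => ul.
have {}ut : u < t.
  by rewrite lt_neqAle ut andbT; apply: contraNneq tl => <-.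
have : count (fun v => s <= v < t) l = 0%N.
  have := count_predUI (fun v => v < s) (fun v => s <= v < t) l.
  rewrite (@eq_count _ (predU _ _) (fun v => v < t)); last first.
    by move=> v /=; have [vs|vs] := ltP v s => //=; lra.
  rewrite (@eq_count _ (predI _ _) pred0); last first.
    by move=> v /=; have [vs|vs] := ltP v s => //=; lra.
  rewrite count_pred0 addn0 -/(rank l t) -e /rank => /eqP.
  by rewrite -[X in X == _]addn0 eqn_add2l => /eqP.
move/eqP; rewrite -leqn0 leqNgt -has_count => /negP; apply.
by apply/hasP; exists u => //; rewrite su.
Qed.

End NearRight.

Section Strands.
Variables (R : realType) (M : one_manifold).

Definition strand_up (S : strand R M) : bool := sfrom S < sto S.

Lemma valid_strand_neq (S : strand R M) : valid_strand S -> sto S - sfrom S != 0.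
Proof.
rewrite /valid_strand subr_eq0; case: ifP => _; last first.
  by case=> + _ _; rewrite eq_sym => /eqP.
by case/andP; rewrite normr_gt0 subr_eq0.
Qed.

(** On a circle, a strand is shorter than one period, so an integer difference of two of its
    parameters is 0. *)
Lemma strand_inj (S : strand R M) s t : valid_strand S ->
  0 <= s <= 1 -> 0 <= t <= 1 ->
  same_pt (scomp S) (sparam S s) (scomp S) (sparam S t) -> s = t.
Proof.
move=> vS s01 t01 [_].
have L0 := valid_strand_neq vS.
have e : sparam S s - sparam S t = (s - t) * (sto S - sfrom S).
  by rewrite /sparam; ring.
case=> [st|[cS [k]]].
  move: e; rewrite st subrr => /esym/eqP; rewrite mulf_eq0 (negbTE L0) orbF.
  by rewrite subr_eq0 => /eqP.
rewrite e => ek; move: vS; rewrite /valid_strand cS => /andP[_ L1].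
have : `|(s - t) * (sto S - sfrom S)| < 1.
  rewrite normrM; apply: le_lt_trans L1; rewrite ler_piMl // ler_norml; lra.
rewrite ek -intr_norm -[1]/(1%:~R) ltr_int -abszE.
rewrite -[1]/(Posz 1) ltz_nat ltnS leqn0 absz_eq0 => /eqP k0.
move: ek => /eqP; rewrite k0 mulf_eq0 (negbTE L0) orbF.
by rewrite subr_eq0 => /eqP.
Qed.

Lemma sparam_in_dom (S : strand R M) s :
  valid_strand S -> 0 <= s <= 1 -> in_dom (scomp S) (sparam S s).
Proof.
rewrite /valid_strand /in_dom /sparam; case: ifP => _; first by left.
by case=> _ /andP[a0 a1] /andP[b0 b1] /andP[s0 s1]; right; nra.
Qed.

Lemma sparam_add (S : strand R M) s h : valid_strand S ->
  sparam S s + h = sparam S (s + h / (sto S - sfrom S)).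
Proof. by move=> /valid_strand_neq L0; rewrite /sparam mulrDl divfK //; ring. Qed.

(** A nested product inherits decidable equality, which membership in lists of crossings relies
    on. *)
Definition xing : Type := ((bool * bool) * ((bool * R) * (bool * R)))%type.
Definition xvirt (x : xing) : bool := x.1.1.
Definition xsgn (x : xing) : bool := x.1.2.
Definition xo (x : xing) : bool * R := x.2.1.
Definition xu (x : xing) : bool * R := x.2.2.

Definition cuts (X : seq xing) (k : bool) : seq R :=
  [seq p.2 | p <- flatten [seq [:: xo x; xu x] | x <- X] & p.1 == k].

Lemma xo_cuts X x : x \in X -> (xo x).2 \in cuts X (xo x).1.
Proof.
move=> xX; apply/mapP; exists (xo x) => //; rewrite mem_filter eqxx /=.
by apply/flatten_mapP; exists x => //; exact: mem_head.
Qed.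

Lemma xu_cuts X x : x \in X -> (xu x).2 \in cuts X (xu x).1.
Proof.
move=> xX; apply/mapP; exists (xu x) => //; rewrite mem_filter eqxx /=.
by apply/flatten_mapP; exists x => //; rewrite !inE eqxx orbT.
Qed.

Definition pos (X : seq xing) (p : bool * R) : nat := rank (cuts X p.1) p.2.

End Strands.

(** * Colorings inside a disk *)

Section Rules.
Variables (R : realType) (Q : quandle) (M : one_manifold) (D : diagram R M).
Variable col : plane R -> Q.

Definition virtual_rule i s : Prop :=
  \forall h \near (0 : R)^'+, col (path D i (s - h)) = col (path D i (s + h)).

Definition classical_rule i s j t : Prop :=
  let e := Num.sg (det (velocity (path D i) s) (velocity (path D j) t)) in
  \forall h \near (0 : R)^'+,
    col (path D i (s - h)) = col (path D i (s + h)) /\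
    col (path D j (t + e * h)) =
      qop (col (path D j (t - e * h))) (col (path D i (s + h))).

End Rules.

Section Tangles.
Variables (R : realType) (M : one_manifold) (D : diagram R M).
Variable S : bool -> strand R M.

Definition pt (p : bool * R) : plane R := spath D (S p.1) p.2.

Notation cmp p := (scomp (S p.1)).
Notation prm p := (sparam (S p.1) p.2).
Notation in01 p := (0 <= p.2 <= 1).

(* The crossings on the strands form the list [X]; a crossing records whether
   it is virtual, the sign of the turn from its first branch (the over-branch
   if it is classical) to its second one, and these two branches. *)
Record realizes (X : seq (xing R)) : Prop := Realizes {
  rz_uniq : forall k, uniq (cuts X k);
  rz_inner : forall k s, s \in cuts X k -> 0 < s < 1;
  rz_pt : forall x, x \in X -> xo x <> xu x /\ pt (xo x) = pt (xu x);
  rz_virt : forall x, x \in X -> virt D (pt (xo x)) = xvirt x;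
  rz_over : forall x, x \in X -> ~~ xvirt x ->
    sover D (S (xo x).1) (xo x).2;
  rz_sign : forall x, x \in X -> ~~ xvirt x ->
    let d := sdet D (S (xo x).1) (xo x).2 (S (xu x).1) (xu x).2 in
    0 < if xsgn x then d else - d;
  rz_complete : forall p q, in01 p -> in01 q -> p <> q -> pt p = pt q ->
    exists2 x, x \in X & x.2 = (p, q) \/ x.2 = (q, p)
}.

Section InDisk.
Variable B : set (plane R).
Hypothesis SB : two_strands_in D B (S false) (S true).

Lemma strands_valid k : valid_strand (S k).
Proof. by case: SB => -[? ?] _ _ _ _; case: k. Qed.

Lemma strands_interior p : in01 p -> (interior B (pt p) <-> 0 < p.2 < 1).
Proof. by case: SB => _ _ _ H0 H1; case: p => -[] s s01; [exact: H1|exact: H0]. Qed.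

Lemma strands_in i t : in_dom i t ->
  (B (path D i t) <-> exists k, on_strand (S k) i t).
Proof.
case: SB => _ _ H _ _ /H ->; split => [[]|[[]]]; [by exists false|by exists true| |];
  by [right|left].
Qed.

Lemma pt_in_disk p : in01 p -> B (pt p).
Proof.
move=> p01; apply/strands_in; first exact/sparam_in_dom/p01/strands_valid.
by exists p.1, p.2 => //; exact: same_pt_refl.
Qed.

Lemma pt_param_inj p q : in01 p -> in01 q ->
  same_pt (cmp p) (prm p) (cmp q) (prm q) -> p = q.
Proof.
case: p q => [k s] [k' s'] /= s01 s01' e.
have [kk'|/eqP kk'] := eqVneq k k'.
  by subst k'; rewrite (strand_inj (strands_valid k) s01 s01' e).
have on1 : on_strand (S k) (scomp (S k)) (sparam (S k) s).
  by exists s => //; exact: same_pt_refl.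
have on2 : on_strand (S k') (scomp (S k)) (sparam (S k) s) by exists s'.
case: SB => _ H _ _ _; case: k k' kk' on1 on2 {s01 e} => -[] // _ o1 o2.
  by case: (H _ _ (conj o2 o1)).
by case: (H _ _ (conj o1 o2)).
Qed.

Lemma pt_crossing p q : in01 p -> in01 q -> p <> q -> pt p = pt q ->
  crossing D (cmp p) (prm p) (cmp q) (prm q).
Proof.
move=> p01 q01 pq e; split; [| | |exact: e].
- exact: sparam_in_dom (strands_valid _) p01.
- exact: sparam_in_dom (strands_valid _) q01.
- by move=> /(pt_param_inj p01 q01).
Qed.

Lemma crossing_on_strand i s j t : crossing D i s j t -> B (path D i s) ->
  exists p q, [/\ same_pt i s (cmp p) (prm p), same_pt j t (cmp q) (prm q),
    in01 p /\ in01 q, p <> q & pt p = pt q].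
Proof.
move=> [is_ jt n e] Bi.
have [k [u u01 eu]] := (strands_in is_).1 Bi.
have [|k' [v v01 ev]] := (strands_in jt).1; first by rewrite -e.
exists (k, u), (k', v); split => //.
- case=> kk' uv; apply: n; apply: same_pt_trans eu _.
  by rewrite kk' uv; exact: same_pt_sym.
- by rewrite /pt /spath /= -(path_same_pt D eu) -(path_same_pt D ev).
Qed.

Variable X : seq (xing R).
Hypothesis rX : realizes X.

Lemma arcs_pt p : in01 p -> (arcs D (pt p) <-> p.2 \notin cuts X p.1).
Proof.
move=> p01; have pd := sparam_in_dom (strands_valid p.1) p01.
rewrite (arcs_path D pd); split=> [H|nc j u x].
  apply/negP => /mapP[r]; rewrite mem_filter => /andP[/eqP r1].
  move=> /flatten_mapP[x xX] rx r2.
  have {r1 r2} rp : p = r by rewrite [p]surjective_pairing [r]surjective_pairing r1 r2.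
  have [n e] := rz_pt rX xX.
  have o01 : in01 (xo x).
    by have /andP[? ?] := rz_inner rX (xo_cuts xX); rewrite !ltW.
  have u01 : in01 (xu x).
    by have /andP[? ?] := rz_inner rX (xu_cuts xX); rewrite !ltW.
  have c := pt_crossing o01 u01 n e.
  move: rx; rewrite !inE rp in H * => /orP[] /eqP rx; rewrite rx in H.
    exact: H c.
  exact: H (crossing_sym c).
have [p' [q [ep eq [p'01 q01] n e]]] := crossing_on_strand x (pt_in_disk p01).
have pp' := pt_param_inj p01 p'01 ep; subst p'.
have [y yX yp] := rz_complete rX p01 q01 n e.
move/negP: nc; apply.
by case: yp => yp; [have := xo_cuts yX|have := xu_cuts yX]; rewrite /xo /xu yp.
Qed.

Lemma pt_uncut_inj p q : in01 p -> in01 q -> p.2 \notin cuts X p.1 ->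
  pt p = pt q -> p = q.
Proof.
move=> p01 q01 /negP nc e; apply: contrapT => n; apply: nc.
have [y yX yp] := rz_complete rX p01 q01 n e.
by case: yp => yp; [have := xo_cuts yX|have := xu_cuts yX]; rewrite /xo /xu yp.
Qed.

Section Colors.
Variable Q : quandle.

(** If [xsgn x] holds, the under-branch goes from right to left of the over-branch, so its left
    color is the one after the crossing, at [n + 1]; otherwise it is the one before. Left and right
    refer to the traversal of the over-strand; if this is against the orientation they are
    exchanged, which replaces [qop] by [qopV]. *)
Definition xing_ok (C : bool -> nat -> Q) (x : xing R) : Prop :=
  let m := pos X (xo x) in let n := pos X (xu x) in
  C (xo x).1 m.+1 = C (xo x).1 m /\
  if xvirt x then C (xu x).1 n.+1 = C (xu x).1 n
  else C (xu x).1 (n + xsgn x)%N =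
    act (strand_up (S (xo x).1)) (C (xu x).1 (n + ~~ xsgn x)%N) (C (xo x).1 m).

(* [C k m] is the color of the strand [k] after [m] passages through
   crossings. *)
Definition discrete_coloring (C : bool -> nat -> Q) : Prop :=
  forall x, x \in X -> xing_ok C x.

Definition follows (col : plane R -> Q) (C : bool -> nat -> Q) : Prop :=
  forall p, in01 p -> p.2 \notin cuts X p.1 -> col (pt p) = C p.1 (pos X p).

Variables (col : plane R -> Q) (C : bool -> nat -> Q).
Hypothesis colC : follows col C.

(** Increasing the parameter of the component means going forward on the strand iff [strand_up]
    holds; this decides which side gets the incremented position. *)
Lemma step_near p : p.2 \in cuts X p.1 ->
  \forall h \near (0 : R)^'+,
    col (path D (cmp p) (prm p + h)) = C p.1 (pos X p + strand_up (S p.1))%N /\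
    col (path D (cmp p) (prm p - h)) = C p.1 (pos X p + ~~ strand_up (S p.1))%N.
Proof.
case: p => k s /= sc; have vS := strands_valid k.
have L0 := valid_strand_neq vS.
set L := sto (S k) - sfrom (S k) in L0 *.
have /andP[s0 s1] := rz_inner rX sc.
have main : \forall h \near (0 : R)^'+,
    col (path D (scomp (S k)) (sparam (S k) (s + h))) = C k (pos X (k, s)).+1 /\
    col (path D (scomp (S k)) (sparam (S k) (s - h))) = C k (pos X (k, s)).
  near=> h.
  have h0 : 0 < h by near: h; exact: nbhs_right_gt.
  have hs : h < s by near: h; exact: nbhs_right_lt.
  have hs1 : h < 1 - s by near: h; apply: nbhs_right_lt; rewrite subr_gt0.
  have [n1 n2 e1 e2] : [/\ s - h \notin cuts X k, s + h \notin cuts X k,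
      rank (cuts X k) (s - h) = rank (cuts X k) s
    & rank (cuts X k) (s + h) = (rank (cuts X k) s).+1].
    by near: h; apply: rank_near => //; exact: rz_uniq rX k.
  have := @colC (k, s + h); rewrite /pos /= e2 /pt /spath /= => -> //; last by lra.
  have := @colC (k, s - h); rewrite /pos /= e1 /pt /spath /= => -> //; last by lra.
have Lp : 0 < `|L|^-1 by rewrite invr_gt0 normr_gt0.
(* A step [h] on the component is a step [h / |L|] on the strand, up to the sign of [L]. *)
have := near_right0_scale Lp main; apply: filterS => h.
rewrite !(sparam_add _ _ vS) -/L /strand_up -subr_gt0 -/L.
have [Lgt|Llt|LE] := ltgtP 0 L; last by rewrite -LE eqxx in L0.
  by rewrite (gtr0_norm Lgt) mulNr [h / L]mulrC addn0 addn1.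
by rewrite (ltr0_norm Llt) invrN mulNr opprK mulNr [h / L]mulrC addn0 addn1 => -[-> ->].
Unshelve. all: by end_near. Qed.

Lemma virtual_ruleE p : p.2 \in cuts X p.1 ->
  virtual_rule D col (cmp p) (prm p) <->
  C p.1 (pos X p).+1 = C p.1 (pos X p).
Proof.
move=> pc; apply: near_right0_iff; have := step_near pc.
apply: filterS => h [-> ->].
by case: strand_up; rewrite /= ?addn0 ?addn1; split=> ->.
Qed.

(** The determinants along the strands and along the orientation differ by the factor [Lo * Lu],
    whose sign compares the two directions of traversal. *)
Lemma xing_det x : x \in X -> ~~ xvirt x ->
  Num.sg (det (velocity (path D (cmp (xo x))) (prm (xo x)))
              (velocity (path D (cmp (xu x))) (prm (xu x)))) =
  (-1) ^+ (xsgn x (+) strand_up (S (xo x).1) (+) ~~ strand_up (S (xu x).1)).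
Proof.
move=> xX xc; have := rz_sign rX xX xc.
have := valid_strand_neq (strands_valid (xo x).1).
have := valid_strand_neq (strands_valid (xu x).1).
have up k : strand_up (S k) = (0 < sto (S k) - sfrom (S k)).
  by rewrite subr_gt0.
rewrite /sdet /svel !up; set d := det _ _; set d' := det _ _.
set Lo := sto (S (xo x).1) - _; set Lu := sto (S (xu x).1) - _.
have -> : d = Lo * Lu * d' by rewrite /d /d' /Lo /Lu /det /=; ring.
clearbody d' Lo Lu => Lu0 Lo0.
have [Lop|Lop|LE] := ltgtP 0 Lo; last by rewrite -LE eqxx in Lo0.
- have [Lup|Lup|LE] := ltgtP 0 Lu; last by rewrite -LE eqxx in Lu0.
  + have LL : 0 < Lo * Lu by nra.
    case: xsgn => /=; rewrite -?mulrN pmulr_rgt0 // ?oppr_gt0 => H.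
      by rewrite gtr0_sg.
    by rewrite ltr0_sg.
  + have LL : Lo * Lu < 0 by nra.
    case: xsgn => /=; rewrite -?mulrN nmulr_rgt0 // ?oppr_lt0 => H.
      by rewrite ltr0_sg.
    by rewrite gtr0_sg.
- have [Lup|Lup|LE] := ltgtP 0 Lu; last by rewrite -LE eqxx in Lu0.
  + have LL : Lo * Lu < 0 by nra.
    case: xsgn => /=; rewrite -?mulrN nmulr_rgt0 // ?oppr_lt0 => H.
      by rewrite ltr0_sg.
    by rewrite gtr0_sg.
  + have LL : 0 < Lo * Lu by nra.
    case: xsgn => /=; rewrite -?mulrN pmulr_rgt0 // ?oppr_gt0 => H.
      by rewrite gtr0_sg.
    by rewrite ltr0_sg.
Qed.

Lemma classical_ruleE x : x \in X -> ~~ xvirt x ->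
  classical_rule D col (cmp (xo x)) (prm (xo x)) (cmp (xu x)) (prm (xu x)) <->
  xing_ok C x.
Proof.
move=> xX xc; rewrite /classical_rule xing_det // /xing_ok (negbTE xc).
apply: near_right0_iff.
have := step_near (xu_cuts xX); have := step_near (xo_cuts xX).
apply: filterS2 => h [-> ->].
case: strand_up; case: strand_up; case: xsgn => /= -[H1 H2];
  rewrite ?expr1 ?expr0 ?mulN1r ?mul1r ?opprK ?H1 ?H2 ?addn0 ?addn1; split.
all: by case=> e1 e2; split; rewrite ?e2 ?qopK ?qopVK ?e1.
Qed.

End Colors.

End InDisk.
End Tangles.

(** * Coloring rules under change of parameter and of color map *)

Section RuleTransport.
Variables (R : realType) (Q : quandle) (M : one_manifold) (D : diagram R M).
Variable col : plane R -> Q.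

Lemma virtual_rule_same_pt i s i' s' : same_pt i s i' s' ->
  virtual_rule D col i' s' -> virtual_rule D col i s.
Proof.
by move=> e; apply: filterS => h; rewrite !(path_same_pt D (same_pt_add _ e)).
Qed.

Lemma classical_rule_same_pt i s j t i' s' j' t' :
  same_pt i s i' s' -> same_pt j t j' t' ->
  classical_rule D col i' s' j' t' -> classical_rule D col i s j t.
Proof.
move=> e e'; rewrite /classical_rule.
rewrite (velocity_same_pt D e) (velocity_same_pt D e') /=.
apply: filterS => h.
by rewrite !(path_same_pt D (same_pt_add _ e)) !(path_same_pt D (same_pt_add _ e')).
Qed.

Lemma near_affine (P : R -> Prop) s (e : R) :
  (\forall u \near s, P u) -> \forall h \near (0 : R)^'+, P (s + e * h).
Proof.
move=> Ps.
have c : (fun h : R => s + e * h) @ (0 : R)^'+ --> s.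
  apply: cvg_at_right_filter.
  have {2}-> : s = s + e * 0 by rewrite mulr0 addr0.
  by apply: cvgD; [exact: cvg_cst|apply: cvgM; [exact: cvg_cst|exact: cvg_id]].
exact: c.
Qed.

Lemma path_near_right (U : set (plane R)) i s (e : R) :
  open U -> U (path D i s) ->
  \forall h \near (0 : R)^'+, U (path D i (s + e * h)).
Proof.
move=> Uo Us; apply: (near_affine (P := fun u => U (path D i u))).
by apply: path_continuous; exact: open_nbhs_nbhs.
Qed.

Variables (U : set (plane R)) (col' : plane R -> Q).
Hypotheses (Uo : open U) (colU : forall p, U p -> col' p = col p).

Lemma virtual_rule_eq_on i s : U (path D i s) ->
  virtual_rule D col i s -> virtual_rule D col' i s.
Proof.
move=> Us; have H1 := path_near_right 1 Uo Us.
have := path_near_right (-1) Uo Us; move: H1; apply: filterS3 => h.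
by rewrite mul1r mulN1r => /colU -> /colU ->.
Qed.

Lemma classical_rule_eq_on i s j t : U (path D i s) -> path D i s = path D j t ->
  classical_rule D col i s j t -> classical_rule D col' i s j t.
Proof.
move=> Us e; have Ut := Us; rewrite e in Ut.
rewrite /classical_rule; set d := Num.sg _ => H.
near=> h.
have : U (path D i (s + 1 * h)) by near: h; exact: path_near_right.
have : U (path D i (s + -1 * h)) by near: h; exact: path_near_right.
have : U (path D j (t + d * h)) by near: h; exact: path_near_right.
have : U (path D j (t + (- d) * h)) by near: h; exact: path_near_right.
rewrite !mulNr !mul1r => /colU -> /colU -> /colU -> /colU ->.
by near: h.
Unshelve. all: by end_near. Qed.

End RuleTransport.

Section ColorsOnStrands.
Variables (R : realType) (M : one_manifold) (D : diagram R M).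
Variables (S : bool -> strand R M) (B : set (plane R)) (X : seq (xing R)).
Hypothesis SB : two_strands_in D B (S false) (S true).
Hypothesis rX : realizes D S X.
Variable Q : quandle.

Lemma endpoint_uncut k : (0 : R) \notin cuts X k /\ (1 : R) \notin cuts X k.
Proof. by split; apply/negP => /(rz_inner rX); lra. Qed.

Lemma pos_start k : pos X (k, 0) = 0%N.
Proof.
rewrite /pos /rank /= -(count_pred0 (cuts X k)); apply: eq_in_count => u.
by move=> /(rz_inner rX)/andP[u0 _] /=; apply/negbTE; rewrite -leNgt ltW.
Qed.

Lemma pos_end k : pos X (k, 1) = size (cuts X k).
Proof.
rewrite /pos /rank /= -(count_predT (cuts X k)); apply: eq_in_count => u.
by move=> /(rz_inner rX)/andP[_ ->].
Qed.

Lemma xings_in01 x : x \in X -> 0 <= (xo x).2 <= 1 /\ 0 <= (xu x).2 <= 1.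
Proof.
move=> xX; have := rz_inner rX (xo_cuts xX); have := rz_inner rX (xu_cuts xX).
by move=> /andP[? ?] /andP[? ?]; split; rewrite !ltW.
Qed.

Variable col : plane R -> Q.

(** Equal ranks mean that no crossing parameter separates [s] from [t], so the strand runs inside
    one arc between them. *)
Lemma coloring_uncut k s t : (forall p q, arcs D p ->
    connected_component (arcs D) p q -> col p = col q) ->
  0 <= s <= 1 -> 0 <= t <= 1 -> s \notin cuts X k -> t \notin cuts X k ->
  rank (cuts X k) s = rank (cuts X k) t ->
  col (pt D S (k, s)) = col (pt D S (k, t)).
Proof.
move=> colC; wlog st : s t / s <= t.
  move=> W; have [st|/ltW ts] := leP s t; first exact: W.
  by move=> *; apply/esym; exact: W.
move=> s01 t01 ns nt e; have vS := strands_valid SB k.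
have L0 := valid_strand_neq vS.
have arc a : s <= a <= t -> arcs D (path D (scomp (S k)) (sparam (S k) a)).
  move=> sat; apply/(arcs_pt SB rX (p := (k, a))); first by rewrite /=; lra.
  exact: rank_eq_notin e ns nt sat.
have inv a : a = sparam (S k) ((a - sfrom (S k)) / (sto (S k) - sfrom (S k))).
  by rewrite /sparam divfK //; ring.
rewrite /pt /spath /=.
have [Lp|Lp|LE] := ltgtP 0 (sto (S k) - sfrom (S k)); last by rewrite -LE eqxx in L0.
  apply: (col_segment colC); first by rewrite /sparam; nra.
  move=> a /andP[a1 a2]; rewrite (inv a); apply: arc.
  rewrite ler_pdivlMr // ler_pdivrMr //; move: a1 a2; rewrite /sparam; lra.
apply/esym/(col_segment colC); first by rewrite /sparam; nra.
move=> a /andP[a1 a2]; rewrite (inv a); apply: arc.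
rewrite ler_ndivlMr // ler_ndivrMr //; move: a1 a2; rewrite /sparam; lra.
Qed.

Lemma coloring_discrete : coloring D col ->
  exists C, follows D S X col C /\ discrete_coloring S X C.
Proof.
move=> [colC virtC classC].
pose G k m := [set s : R | [/\ 0 <= s <= 1, s \notin cuts X k & rank (cuts X k) s = m]].
(* The color at a chosen uncut parameter of rank [m]; by [coloring_uncut] the choice is immaterial.
   The default 0 serves the ranks beyond the number of cuts. *)
pose C k m := col (pt D S (k, xget 0 (G k m))).
have colF : follows D S X col C.
  case=> k s /= s01 sc; rewrite /C.
  have [t01 tc e] : G k (pos X (k, s)) (xget 0 (G k (pos X (k, s)))).
    by apply: xgetPex; exists s.
  exact: coloring_uncut.
exists C; split => // x xX.
have [xo01 xu01] := xings_in01 xX; have [n e] := rz_pt rX xX.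
have c := pt_crossing SB xo01 xu01 n e.
have [xv|xc] := boolP (xvirt x).
  have vo : virt D (pt D S (xo x)) by rewrite (rz_virt rX).
  rewrite /xing_ok xv; split.
    apply/(virtual_ruleE SB rX colF (xo_cuts xX)); exact: virtC c vo.
  apply/(virtual_ruleE SB rX colF (xu_cuts xX)).
  by apply: virtC (crossing_sym c) _; move: vo; rewrite e.
apply/(classical_ruleE SB rX colF xX xc); apply: classC c _ _.
  by rewrite [virt _ _](rz_virt rX).
by have := rz_over rX xX xc.
Qed.

End ColorsOnStrands.

(** * Gluing colorings *)

Lemma rank_locally_constant (R : realType) (l : seq R) s : s \notin l ->
  \forall u \near s, rank l u = rank l s.
Proof.
rewrite /rank; elim: l => [|a l IH]; first by move=> _; near=> u.
rewrite inE negb_or => /andP[sa /IH]; apply: filterS2 => /=.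
  by move=> u e1 e2; congr (_ + _)%N; [exact: e1|exact: e2].
have [sa'|sa'|e] := ltgtP a s; last by rewrite e eqxx in sa.
- have : \forall u \near s, a < u by exact: lt_nbhsr.
  by apply: filterS => u ->.
- have : \forall u \near s, u < a by exact: lt_nbhsl.
  by apply: filterS => u ua; rewrite ltNge ltW.
Unshelve. all: by end_near. Qed.

Section Gluing.
Variables (R : realType) (M : one_manifold) (D : diagram R M).
Variables (S : bool -> strand R M) (B : set (plane R)) (X : seq (xing R)).
Hypothesis Bc : closed B.
Hypothesis SB : two_strands_in D B (S false) (S true).
Hypothesis rX : realizes D S X.
Variables (Q : quandle) (C : bool -> nat -> Q) (col0 : plane R -> Q).
Hypothesis Cok : discrete_coloring S X C.

(** An uncut point has one preimage on the two strands, so by compactness only its own interval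
    comes near it. *)
Lemma strand_near k s : 0 <= s <= 1 -> s \notin cuts X k ->
  \forall q \near pt D S (k, s), forall k' u, 0 <= u <= 1 ->
    pt D S (k', u) = q -> k' = k /\ rank (cuts X k) u = rank (cuts X k) s.
Proof.
move=> s01 sc.
pose A k' := if k' == k then [set u | rank (cuts X k) u = rank (cuts X k) s]°
  else set0.
have gc k' : continuous (fun u => pt D S (k', u)).
  move=> u; rewrite /pt /spath /=.
  apply: (@continuous_comp _ _ _ (sparam (S k')) (path D (scomp (S k')))).
    apply: cvgD; first exact: cvg_cst.
    by apply: cvgM; [exact: cvg_id|exact: cvg_cst].
  exact: path_continuous.
have Ao k' : open (A k').
  by rewrite /A; case: ifP => _; [exact: open_interior|exact: open0].
have key k' u : 0 <= u <= 1 -> pt D S (k', u) = pt D S (k, s) -> A k' u.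
  move=> u01 e.
  have [<- <-] := pt_uncut_inj rX (p := (k, s)) (q := (k', u)) s01 u01 sc (esym e).
  by rewrite /A eqxx; exact: rank_locally_constant.
have := curves_near gc Ao key; apply: filterS => q H k' u u01 e.
by have := H k' u u01 e; rewrite /A; case: eqP => // -> /interior_subset.
Qed.

(** The new coloring follows [C] on the strands and [col0] elsewhere. The two prescriptions overlap
    only at the ends of the strands, where the first two hypotheses reconcile them. *)
Lemma glue_coloring :
  (forall k, col0 (pt D S (k, 0)) = C k 0) ->
  (forall k, col0 (pt D S (k, 1)) = C k (size (cuts X k))) ->
  locally_constant_on (arcs D `\` B°) col0 ->
  (forall i s j t, crossing D i s j t -> ~ B (path D i s) ->
    virt D (path D i s) -> virtual_rule D col0 i s) ->
  (forall i s j t, crossing D i s j t -> ~ B (path D i s) ->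
    ~~ virt D (path D i s) -> over D i s -> classical_rule D col0 i s j t) ->
  exists col, coloring D col /\ forall p, ~ B° p -> col p = col0 p.
Proof.
move=> start fin lc0 virt0 class0.
have [col Hcol] : { col : plane R -> Q & forall p, (~ B° p -> col p = col0 p) /\
    forall r, 0 <= r.2 <= 1 -> r.2 \notin cuts X r.1 -> pt D S r = p ->
      col p = C r.1 (pos X r) }.
  apply: (boolp.choice (P := fun p q => (~ B° p -> q = col0 p) /\
    forall r, 0 <= r.2 <= 1 -> r.2 \notin cuts X r.1 -> pt D S r = p ->
      q = C r.1 (pos X r))) => p.
  have [[r [r01 rc rp]]|n] := pselect (exists r,
    [/\ 0 <= r.2 <= 1, r.2 \notin cuts X r.1 & pt D S r = p]); last first.
    by exists (col0 p); split => // r r01 rc rp; exfalso; apply: n; exists r.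
  exists (C r.1 (pos X r)); split => [nB|r' r'01 r'c r'p]; last first.
    by rewrite (pt_uncut_inj rX r01 r'01 rc) // rp.
  (* A strand point outside the interior of [B] is an end. *)
  have : r.2 = 0 \/ r.2 = 1.
    apply: contrapT => n; apply: nB; rewrite -rp.
    apply/(strands_interior SB r01).
    have [r0 r1] : r.2 != 0 /\ r.2 != 1.
      by split; apply/eqP => e; apply: n; [left|right].
    by case/andP: r01 => ? ?; rewrite !lt_neqAle eq_sym r0 r1; apply/andP.
  rewrite -rp; case: r {r01 rc rp} => k s /= [] ->.
    by rewrite (pos_start rX) start.
  by rewrite (pos_end rX) fin.
have colout p : ~ B° p -> col p = col0 p by case: (Hcol p).
have colF : follows D S X col C by move=> r r01 rc; have [_] := Hcol (pt D S r); exact.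
have outo : open (~` B) by exact: closed_openC.
have colB p : (~` B) p -> col p = col0 p.
  by move=> nB; apply: colout => /interior_subset.
exists col; split => //; split.
- suff lc : locally_constant_on (arcs D) col.
    by move=> p q _ /(locally_constant_component lc).
  move=> p Ap; have [[i [t [it pe]]] _] := Ap; subst p.
  have near0 : ~ B° (path D i t) -> \forall q \near path D i t,
      arcs D q -> ~ B° q -> col q = col (path D i t).
    move=> nB; have := lc0 _ (conj Ap nB); apply: filterS => q H Aq nBq.
    by rewrite !colout //; exact: H.
  have [Bp|nBp] := pselect (B (path D i t)); last first.
    have := near0 (contra_not (@interior_subset _ B _) nBp).
    have : \forall q \near path D i t, ~ B q by exact: open_nbhs_nbhs.
    by apply: filterS2 => q nBq + Aq; apply => // /interior_subset.
  have [k [s s01 e]] := (strands_in SB it).1 Bp.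
  have pe : path D i t = pt D S (k, s) by rewrite (path_same_pt D e).
  have sc : s \notin cuts X k.
    by apply/(arcs_pt SB rX (p := (k, s)) s01); rewrite -pe.
  (* Nearby points outside [B]: there are none if the point is interior to [B]; at an end of a
     strand the local constancy of [col0] applies. The points inside [B] are left to
     [strand_near]. *)
  have pre : \forall q \near path D i t, arcs D q -> ~ B q ->
      col q = col (path D i t).
    have [Bi|nBi] := pselect (B° (path D i t)).
      have : \forall q \near path D i t, B° q by exact: nbhs_interior.
      by apply: filterS => q /interior_subset.
    have := near0 nBi; apply: filterS => q H Aq nBq; apply: H => //.
    by move=> /interior_subset.
  have := strand_near s01 sc; rewrite -pe; move: pre.
  apply: filterS2 => q pre H Aq.
  have [Bq|] := pselect (B q); last exact: pre.
  have [[j [u [ju uq]]] _] := Aq; subst q.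
  have [k' [v v01 ev]] := (strands_in SB ju).1 Bq.
  have qe : path D j u = pt D S (k', v) by rewrite (path_same_pt D ev).
  have [kk re] := H k' v v01 (esym qe); subst k'.
  have vc : v \notin cuts X k.
    by apply/(arcs_pt SB rX (p := (k, v)) v01); rewrite -qe.
  rewrite qe pe (colF (k, v)) // (colF (k, s)) //.
  by rewrite /pos /= re.
- move=> i s j t x v.
  have [Bs|nBs] := pselect (B (path D i s)); last first.
    apply: (virtual_rule_eq_on outo colB nBs); exact: virt0 x nBs v.
  have [p [q [ep eq [p01 q01] n e]]] := crossing_on_strand SB x Bs.
  apply: (virtual_rule_same_pt ep).
  have [y yX yp] := rz_complete rX p01 q01 n e.
  have yv : xvirt y.
    rewrite -(rz_virt rX yX); rewrite (path_same_pt D ep) in v.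
    by case: yp => yp; rewrite /xo yp //= -e.
  have := Cok yX; rewrite /xing_ok yv => -[c1 c2].
  have yo := xo_cuts yX; have yu := xu_cuts yX.
  by case: yp => yp; rewrite /xo /xu yp /= in c1 c2 yo yu;
    apply/(virtual_ruleE SB rX colF).
- move=> i s j t x v o.
  have [Bs|nBs] := pselect (B (path D i s)); last first.
    case: (x) => _ _ _ e.
    apply: (classical_rule_eq_on outo colB nBs e); exact: class0 x nBs v o.
  have [p [q [ep eq [p01 q01] n e]]] := crossing_on_strand SB x Bs.
  apply: (classical_rule_same_pt ep eq).
  have [y yX yp] := rz_complete rX p01 q01 n e.
  have yv : ~~ xvirt y.
    rewrite -(rz_virt rX yX); rewrite (path_same_pt D ep) in v.
    by case: yp => yp; rewrite /xo yp //= -e.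
  have yover := rz_over rX yX yv.
  have := (classical_ruleE SB rX colF yX yv).2 (Cok yX).
  case: yp => yp; first by rewrite /xo /xu yp.
  (* The listing puts the over-branch first; if that were [q], both branches would be over, against
     [diag_over]. *)
  exfalso; move: yover; rewrite /xo yp /sover /=.
  have := diag_over (pt_crossing SB p01 q01 n e).
  rewrite (path_same_pt D ep) in v; move=> /(_ v).
  by rewrite -(over_same_pt ep x) ?(path_same_pt D ep) // o => /esym/negbTE ->.
Qed.

End Gluing.

(** * Moves expressed by relations between end colors *)

Section Moves.
Variables (R : realType) (M : one_manifold) (Q : quandle).

(* [Rel a b] is the relation between the colors [a] of the starting points and
   [b] of the end points of the two strands that is imposed by the crossings. *)
Definition tangle (D : diagram R M) (S : bool -> strand R M)
    (Rel : (bool -> Q) -> (bool -> Q) -> Prop) : Prop :=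
  exists X, realizes D S X /\ forall a b, Rel a b <->
    exists C, [/\ discrete_coloring S X C, forall k, C k 0 = a k
      & forall k, C k (size (cuts X k)) = b k].

Lemma sqr_norm_continuous :
  continuous (fun p : plane R => p.1 ^+ 2 + p.2 ^+ 2).
Proof.
move=> p.
have c1 : (fun q : plane R => q.1) @ p --> p.1 by exact: cvg_fst.
have c2 : (fun q : plane R => q.2) @ p --> p.2 by exact: cvg_snd.
exact: (cvgD (cvgM c1 c1) (cvgM c2 c2)).
Qed.

Lemma unit_disk_closed : closed (@unit_disk R).
Proof.
apply: (@preimage_closed _ _ (fun p : plane R => p.1 ^+ 2 + p.2 ^+ 2)
  [set x : R | x <= 1]).
  by move=> p _; exact: sqr_norm_continuous.
exact: (@closed_le R 1).
Qed.

Lemma is_disk_closed (B : set (plane R)) : is_disk B -> closed B.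
Proof.
move=> [f [fc _ ->]]; apply: compact_closed; first exact: norm_hausdorff.
apply: continuous_compact => //.
apply: (subclosed_compact _ (compact_setX (@segment_compact R (-1) 1)
  (@segment_compact R (-1) 1))).
  exact: unit_disk_closed.
by move=> [x y]; rewrite /unit_disk /= !in_itv /=; split; nra.
Qed.

Lemma endpoint_outside (D : diagram R M) S B k (s : R) :
  two_strands_in D B (S false) (S true) -> s = 0 \/ s = 1 ->
  ~ B° (pt D S (k, s)).
Proof.
move=> SB se; have s01 : 0 <= s <= 1 by case: se => ->; rewrite lexx ler01.
move/(strands_interior SB (p := (k, s)) s01) => /=.
by case: se => ->; rewrite ltxx ?andbF.
Qed.

Lemma local_change_endpoint (D D' : diagram R M) S B k (s : R) :
  local_change D D' B (S false) (S true) -> s = 0 \/ s = 1 ->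
  pt D' S (k, s) = pt D S (k, s).
Proof.
move=> [_ [agree _] SB _] se; apply/esym/agree.
  apply: sparam_in_dom (strands_valid SB k) _.
  by case: se => ->; rewrite lexx ler01.
by left; exact: endpoint_outside SB se.
Qed.

Lemma tangle_coloring (D : diagram R M) S B Rel (col : plane R -> Q) :
  two_strands_in D B (S false) (S true) -> tangle D S Rel -> coloring D col ->
  Rel (fun k => col (pt D S (k, 0))) (fun k => col (pt D S (k, 1))).
Proof.
move=> SB [X [rX RelE]] colD; apply/RelE.
have [C [colF Cok]] := coloring_discrete SB rX colD.
exists C; split => // k.
  rewrite colF; first by rewrite (pos_start rX).
    by rewrite /= lexx ler01.
  by have [] := endpoint_uncut rX k.
rewrite colF; first by rewrite (pos_end rX).
  by rewrite /= lexx ler01.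
by have [] := endpoint_uncut rX k.
Qed.

(** For a diagram contained in the disk, only the ends of the strands lie outside the interior, so
    any admissible end colors come from a coloring of the whole diagram. *)
Lemma tangle_exists_coloring (D : diagram R M) S B Rel a b :
  closed B -> two_strands_in D B (S false) (S true) ->
  (forall i t, in_dom i t -> B (path D i t)) -> tangle D S Rel -> Rel a b ->
  exists col, [/\ coloring D col, forall k, col (pt D S (k, 0)) = a k
    & forall k, col (pt D S (k, 1)) = b k].
Proof.
move=> Bc SB allB [X [rX RelE]] /RelE [C [Cok Ca Cb]].
pose endpt (r : bool * R) := r.2 = 0 \/ r.2 = 1.
have end01 r : endpt r -> 0 <= r.2 <= 1 /\ r.2 \notin cuts X r.1.
  by move=> [] ->; have [? ?] := endpoint_uncut rX r.1; rewrite lexx ler01.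
have [q0] := quandle_inhabited Q.
(* The outer color map for the gluing: prescribed at the four ends, and an arbitrary element [q0]
   elsewhere. *)
have [col0 Hcol] : { col0 : plane R -> Q & forall p r, endpt r ->
    pt D S r = p -> col0 p = C r.1 (pos X r) }.
  apply: (boolp.choice (P := fun p q => forall r, endpt r ->
    pt D S r = p -> q = C r.1 (pos X r))) => p.
  have [[r [re rp]]|n] := pselect (exists r, endpt r /\ pt D S r = p); last first.
    by exists q0 => r re rp; exfalso; apply: n; exists r.
  exists (C r.1 (pos X r)) => r' re' rp'.
  have [r01 rc] := end01 _ re; have [r'01 _] := end01 _ re'.
  by rewrite (pt_uncut_inj rX r01 r'01 rc) // rp.
have start k : col0 (pt D S (k, 0)) = C k 0.
  by rewrite (Hcol _ (k, 0)) //= ?(pos_start rX) //; left.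
have fin k : col0 (pt D S (k, 1)) = C k (size (cuts X k)).
  by rewrite (Hcol _ (k, 1)) //= ?(pos_end rX) //; right.
have ends p : arcs D p -> ~ B° p -> exists2 r, endpt r & p = pt D S r.
  move=> [[i [t [it <-]]] _] nB.
  have [k [s s01 e]] := (strands_in SB it).1 (allB _ _ it).
  exists (k, s); last by rewrite (path_same_pt D e).
  apply: contrapT => n; apply: nB; rewrite (path_same_pt D e).
  apply/(strands_interior SB (p := (k, s)) s01) => /=.
  have [s0 s1] : s != 0 /\ s != 1.
    by split; apply/eqP => se; apply: n; [left|right].
  by case/andP: s01 => ? ?; rewrite !lt_neqAle eq_sym s0 s1; apply/andP.
have lc : locally_constant_on (arcs D `\` B°) col0.
  move=> p [Ap nB]; have [[k s] re ->] := ends p Ap nB.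
  have [s01 sc] := end01 _ re.
  have := strand_near rX s01 sc; apply: filterS => q H [Aq nBq].
  have [[k' u] re' qe] := ends q Aq nBq.
  have [u01 _] := end01 _ re'.
  have [kk e] := H k' u u01 (esym qe); subst k'.
  by rewrite qe (Hcol _ _ re' erefl) (Hcol _ _ re erefl) /pos /= e.
have [||col [colD out]] := glue_coloring Bc SB rX Cok start fin lc.
- by move=> i s j t [is_ _ _ _] /(_ (allB _ _ is_)).
- by move=> i s j t [is_ _ _ _] /(_ (allB _ _ is_)).
exists col; split => // k.
  by rewrite out ?start ?Ca //; apply: endpoint_outside SB _; left.
by rewrite out ?fin ?Cb //; apply: endpoint_outside SB _; right.
Qed.

Section Transfer.
Variables (D D' : diagram R M) (B : set (plane R)).
Hypothesis agree : forall i t, in_dom i t ->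
  ~ B° (path D i t) \/ ~ B° (path D' i t) -> path D i t = path D' i t.

Lemma crossing_outside i s j t :
  crossing D i s j t -> ~ B° (path D i s) -> crossing D' i s j t.
Proof.
move=> [is_ jt n e] nB; split=> //.
by rewrite -(agree is_) ?e; [apply: agree => //; left; rewrite -e|left; rewrite -e].
Qed.

Lemma paths_near_eq i s j t : closed B ->
  crossing D i s j t -> ~ B (path D i s) ->
  \forall u \near s, path D i u = path D' i u.
Proof.
move=> Bc x nB.
have : \forall u \near s, ~ B (path D i u).
  apply: (@path_continuous _ _ D i s (~` B)).
  by apply: open_nbhs_nbhs; split => //; exact: closed_openC.
(* On an interval, [agree] speaks only of parameters in [[0, 1]]; a crossing parameter is inner, so
   a full neighborhood is covered and velocities can be compared. *)
have := inner_dom_near (diag_dbl_inner x).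
apply: filterS2 => u /inner_in_dom iu nBu; apply: agree => //.
by left => /interior_subset.
Qed.

End Transfer.

Lemma velocity_near_eq (f g : R -> plane R) s :
  (\forall u \near s, f u = g u) -> velocity f s = velocity g s.
Proof.
move=> fg; rewrite /velocity !derive1E.
by congr (_, _); apply: near_eq_derive; move: fg; apply: filterS => u ->.
Qed.

(** The given [col] itself is the outer color map for the gluing: off [B], the two diagrams coincide
    near each crossing, so its rules carry over to [D']. *)
Lemma tangle_extend (D D' : diagram R M) S B Rel (col : plane R -> Q) :
  local_change D D' B (S false) (S true) -> coloring D col ->
  tangle D' S Rel ->
  Rel (fun k => col (pt D S (k, 0))) (fun k => col (pt D S (k, 1))) ->
  exists col', coloring D' col' /\ forall p, arcs D p -> ~ B° p -> col' p = col p.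
Proof.
move=> lcDD' colD [X [rX RelE]] /RelE[C [Cok Ca Cb]].
have [[diskB _] [agree agreex] SB SB'] := lcDD'.
have agree' i t : in_dom i t ->
    ~ B° (path D' i t) \/ ~ B° (path D i t) -> path D' i t = path D i t.
  by move=> it /or_comm /(agree _ _ it).
have Bc := is_disk_closed diskB.
have ptE k s : (s = 0 \/ s = 1) -> pt D' S (k, s) = pt D S (k, s).
  exact: local_change_endpoint lcDD'.
have [colC virtC classC] := colD.
have lc : locally_constant_on (arcs D' `\` B°) col.
  move=> p [Ap nB].
  have arcsD q : arcs D' q -> ~ B° q -> arcs D q.
    move=> [[i [t [it <-]]] nx] nBq; split.
      by exists i, t; split => //; apply: agree => //; right.
    move=> [i' [s [j [u [x e]]]]]; apply: nx; exists i', s, j, u.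
    rewrite -e in nBq; split; first exact: (crossing_outside agree x nBq).
    by rewrite -e; apply: agree'; [case: x|right].
  have := col_locally_constant colC (arcsD p Ap nB).
  by apply: filterS => q H [Aq nBq]; apply: H; exact: arcsD.
have xD i s j t : crossing D' i s j t -> ~ B (path D' i s) ->
  [/\ crossing D i s j t, path D' i s = path D i s & ~ B° (path D i s)].
  move=> x nB; have nBi := contra_not (@interior_subset _ B _) nB.
  have e : path D' i s = path D i s by apply: agree'; [case: x|left].
  by split => //; [exact: (crossing_outside agree' x nBi)|rewrite -e].
have Rnear i s j t e : crossing D' i s j t ->
    ~ B (path D' i s) -> (\forall h \near (0 : R)^'+, path D' i (s + e * h) =
      path D i (s + e * h)).
  move=> x nB; apply: (near_affine (P := fun u => path D' i u = path D i u)).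
  exact: (paths_near_eq agree' Bc x nB).
have start k : col (pt D' S (k, 0)) = C k 0 by rewrite ptE ?Ca //; left.
have fin k : col (pt D' S (k, 1)) = C k (size (cuts X k)).
  by rewrite ptE ?Cb //; right.
have [||col' [col'D out]] := glue_coloring Bc SB' rX Cok start fin lc.
- move=> i s j t x nB v.
  have [xD' e nBi] := xD _ _ _ _ x nB.
  have [ve _] := agreex _ _ _ _ xD' nBi.
  rewrite e -ve in v; have := virtC _ _ _ _ xD' v.
  have H1 := Rnear _ _ _ _ 1 x nB; have := Rnear _ _ _ _ (-1) x nB.
  by move: H1; apply: filterS3 => h; rewrite mulN1r mul1r => -> ->.
- move=> i s j t x nB v o.
  have [xD' e nBi] := xD _ _ _ _ x nB.
  have [ve oe] := agreex _ _ _ _ xD' nBi.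
  rewrite e -ve in v; have := oe v; rewrite o => oD.
  have xs := crossing_sym x.
  have nBt : ~ B (path D' j t) by case: (x) => _ _ _ <-.
  have := classC _ _ _ _ xD' v oD; rewrite /classical_rule.
  have -> : velocity (path D' i) s = velocity (path D i) s.
    exact/velocity_near_eq/(paths_near_eq agree' Bc x nB).
  have -> : velocity (path D' j) t = velocity (path D j) t.
    exact/velocity_near_eq/(paths_near_eq agree' Bc xs nBt).
  rewrite /=; set d := Num.sg _ => H; near=> h.
  have : path D' i (s + 1 * h) = path D i (s + 1 * h).
    by near: h; exact: Rnear x nB.
  have : path D' i (s + -1 * h) = path D i (s + -1 * h).
    by near: h; exact: Rnear x nB.
  have : path D' j (t + d * h) = path D j (t + d * h).
    by near: h; exact: Rnear xs nBt.
  have : path D' j (t + - d * h) = path D j (t + - d * h).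
    by near: h; exact: Rnear xs nBt.
  rewrite !mulNr !mul1r => -> -> -> ->.
  by near: h.
exists col'; split => // p Ap nBp; exact: out.
Unshelve. all: by end_near. Qed.

(** Realize [a] and [b] by a coloring of [D], extend it, and read the ends in [D']: they are arc
    points outside the interior, so their colors have not changed. *)
Lemma extension_rel (D D' : diagram R M) S B Rel Rel' :
  local_change D D' B (S false) (S true) ->
  (forall i t, in_dom i t -> B (path D i t)) ->
  tangle D S Rel -> tangle D' S Rel' ->
  (forall col : plane R -> Q, coloring D col -> exists col',
    coloring D' col' /\ forall p, arcs D p -> ~ B° p -> col' p = col p) ->
  forall a b, Rel a b -> Rel' a b.
Proof.
move=> lc allB tD tD' ext a b rel; have [[diskB _] _ SB SB'] := lc.
have Bc := is_disk_closed diskB.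
have [col [colD cola colb]] := tangle_exists_coloring Bc SB allB tD rel.
have [col' [colD' col'E]] := ext col colD.
have endE k s : s = 0 \/ s = 1 -> col' (pt D' S (k, s)) = col (pt D S (k, s)).
  move=> se; rewrite (local_change_endpoint k lc se).
  apply: col'E; last exact: endpoint_outside SB se.
  have [X [rX _]] := tD; have [n0 n1] := endpoint_uncut rX k.
  have s01 : 0 <= s <= 1 by case: se => ->; rewrite lexx ler01.
  by apply/(arcs_pt SB rX (p := (k, s)) s01); case: se => ->.
have := tangle_coloring SB' tD' colD'.
congr Rel'; apply/funext => k; first by rewrite endE; [exact: cola|left].
by rewrite endE; [exact: colb|right].
Qed.

End Moves.

(** * Quandle identities *)

Section QuandleIdentities.
Variable Q : quandle.
Implicit Types x y z : Q.

Lemma act_idem b x : act b x x = x.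
Proof. by case: b => /=; [exact: qop_idem|rewrite -{1}(qop_idem x) qopK]. Qed.

(** Acting by [z] is an automorphism for [qop], hence also for [qopV], and so is its inverse. *)
Lemma act_dist d e x y z : act d (act e x y) z = act e (act d x z) (act d y z).
Proof.
have d1 e' u v w : act true (act e' u v) w = act e' (act true u w) (act true v w).
  case: e'; first exact: qop_dist.
  by apply/(act_eq_sym true) => /=; rewrite -qop_dist qopVK.
case: d; first exact: d1.
apply/esym/(act_eq_sym false); rewrite d1.
by congr act; rewrite (actK true).
Qed.

(** Acting by [act c y z] is the conjugate, by the action of [z], of the action of [y]. *)
Lemma act_act b c x y z : act b x (act c y z) = act c (act b (act (~~ c) x z) y) z.
Proof. by rewrite act_dist actK. Qed.

Lemma act_act_l b c x y : act b x (act c y x) = act c (act b x y) x.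
Proof. by rewrite act_act act_idem. Qed.

(** Cancelling the outer action of [x] in the two given identities yields the two that start with
    [qopV x y]. *)
Lemma coherent4E : coherent4 Q <->
  forall d e x y, act d (act e x y) x = act (~~ e) x y.
Proof.
split=> [H d e x y|H x y]; last first.
  have H1 := H true true x y; have H2 := H false true x y.
  by split; [rewrite -[LHS]/(act true (act true x y) x) H1|].
have H1 : qopV (qop x y) x = qopV x y by have [] := H x y.
have H2 : qop (qop x y) x = qopV x y by have [-> ->] := H x y.
have e1 : qop (qopV x y) x = qop x y by rewrite -H1 qopVK.
have e2 : qopV (qopV x y) x = qop x y by rewrite -H2 qopK.
by case: d; case: e.
Qed.

(* [a] and [b] give the colors at the starts and at the ends of the two strands,
   [false] being the left strand [S1] of the twist, resp. the strand [l] of the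
   wink; the booleans [e1], [e2], [el], [er] say whether the strands are
   traversed along their orientation. *)
Definition twist_rel (e1 e2 pos : bool) (a b : bool -> Q) : Prop :=
  if pos then b true = act e1 (a true) (a false) /\
              b false = act e2 (a false) (b true)
  else b false = act (~~ e2) (a false) (a true) /\
       b true = act (~~ e1) (a true) (b false).

(** In K, l crosses r from right to left at the upper point and from left to right at the lower one,
    for the traversal of r; hence [er == up]. In cK it runs backwards, hence [er != up] below. *)
Definition K_rel (er up : bool) (a b : bool -> Q) : Prop :=
  b true = a true /\ b false = act (er == up) (a false) (a true).

(* [o] says that the strand [l] passes first over the crossing [c]. *)
Definition cK_rel (o el er up : bool) (a b : bool -> Q) : Prop :=
  b true = a true /\
  if o then
    b false = act (~~ el) (act (er != up) (a false) (a true)) (a false)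
  else b false = act (er != up) (act el (a false) (b false)) (a true).

Lemma twist_rel_flip e1 e2 pos a b : coherent4 Q ->
  twist_rel e1 e2 pos a b -> twist_rel e1 e2 (~~ pos) a b.
Proof.
move/coherent4E => H; case: pos => -[h1 h2].
  have h3 : b false = act (~~ e2) (a false) (a true).
    by rewrite h2 h1 act_act_l H.
  by split=> //; rewrite h1 h3 act_act_l H negbK.
have h3 : b true = act e1 (a true) (a false).
  by rewrite h2 h1 act_act_l H negbK.
by split=> //; rewrite h1 h3 act_act_l H.
Qed.

(** If [o] holds, this is one instance of coherence. Otherwise the equation is implicit in
    [b false], and [key] makes it explicit. *)
Lemma cK_rel_K_rel o el er up a b : coherent4 Q ->
  cK_rel o el er up a b <-> K_rel er up a b.
Proof.
move/coherent4E => H; rewrite /cK_rel /K_rel; case: o.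
  by rewrite H negbK.
move: (a false) (a true) (b false) => z y w.
(* With [x] the color of l on the loop and [w] the result of acting on [x] by [y], this says that
   the passage through c undone on [x] amounts to acting once more by [y]; so [z] and [w] differ by
   a single action of [y]. *)
have key d e u : act d u (act e u y) = act e (act e u y) y.
  by rewrite act_act H negbK.
split=> -[-> e]; split=> //.
  apply/act_eq_sym; set x := act el z w in e.
  have -> : z = act (~~ el) x w by exact: (act_eq_sym el x z w).1.
  by rewrite {1}e key -e.
by rewrite {2}e key actNK.
Qed.

End QuandleIdentities.

(** * The configurations of the moves *)

Section Configurations.
Variables (R : realType) (M : one_manifold) (Q : quandle) (D : diagram R M).
Variables (S : bool -> strand R M) (B : set (plane R)).
Hypothesis SB : two_strands_in D B (S false) (S true).

Lemma sdet_antisym (T T' : strand R M) s s' :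
  sdet D T' s' T s = - sdet D T s T' s'.
Proof. by rewrite /sdet /det; ring. Qed.

Lemma sover_other p q : 0 <= p.2 <= 1 -> 0 <= q.2 <= 1 -> p <> q ->
  pt D S p = pt D S q -> ~~ svirt D (S p.1) p.2 ->
  sover D (S p.1) p.2 = ~~ sover D (S q.1) q.2.
Proof. by move=> p01 q01 n e v; exact: (diag_over (pt_crossing SB p01 q01 n e)). Qed.

Lemma itv01 (x : R) : 0 < x -> x < 1 -> 0 <= x <= 1.
Proof. by move=> x0 x1; rewrite !ltW. Qed.

Lemma lt_facts (a b : R) : a < b ->
  ((a < b) = true) * ((b < a) = false) * ((a == b) = false) * ((b == a) = false).
Proof. by move=> ab; rewrite ab lt_gtF // lt_eqF // gt_eqF. Qed.

Lemma full_twist_tangle sgn : full_twist D (S false) (S true) sgn ->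
  tangle D S (@twist_rel Q (strand_up (S false)) (strand_up (S true)) sgn).
Proof.
move=> [s1 [s2 [t1 [t2 [[[s10 s12 s21] [t10 t12 t21]] [simf simt meet] [d1 d2]
  [v1 v2] [p1 p2]]]]]].
have s11 := lt_trans s12 s21; have s20 := lt_trans s10 s12.
have t11 := lt_trans t12 t21; have t20 := lt_trans t10 t12.
have s101 := itv01 s10 s11; have s201 := itv01 s20 s21.
have t101 := itv01 t10 t11; have t201 := itv01 t20 t21.
have e1 : pt D S (false, s1) = pt D S (true, t1) by apply/meet => //; left.
have e2 : pt D S (false, s2) = pt D S (true, t2) by apply/meet => //; right.
(* The strand that is over changes from one crossing to the next, and with the over-branch listed
   first both crossings have sign [sgn]. *)
pose X : seq (xing R) := if sgn
  then [:: ((false, true), ((false, s1), (true, t1)));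
           ((false, true), ((true, t2), (false, s2)))]
  else [:: ((false, false), ((true, t1), (false, s1)));
           ((false, false), ((false, s2), (true, t2)))].
have cf : cuts X false = [:: s1; s2] by rewrite /X; case: (sgn).
have ct : cuts X true = [:: t1; t2] by rewrite /X; case: (sgn).
have over1 : sover D (S false) s1 = sgn.
  move: p1; rewrite /positive_half_twist [sdet D (S true) _ _ _]sdet_antisym oppr_gt0.
  by case: ifP => _ <-; [rewrite d1|rewrite lt_gtF].
have over2 : sover D (S false) s2 = ~~ sgn.
  move: p2; rewrite /positive_half_twist [sdet D (S true) _ _ _]sdet_antisym oppr_gt0.
  by case: ifP => _ <-; [rewrite lt_gtF|rewrite d2].
have over1' : sover D (S true) t1 = ~~ sgn.
  have := sover_other (p := (false, s1)) (q := (true, t1)) s101 t101 _ e1 v1.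
  by rewrite /= over1 => ->; rewrite ?negbK.
have over2' : sover D (S true) t2 = sgn.
  have := sover_other (p := (false, s2)) (q := (true, t2)) s201 t201 _ e2 v2.
  by rewrite /= over2 => /(_ _)/negb_inj <-.
exists X; split.
  split.
  - by case; rewrite ?cf ?ct /= inE ?(lt_facts s12) ?(lt_facts t12).
  - by case=> s; rewrite ?cf ?ct !inE => /orP[]/eqP->; apply/andP.
  - by rewrite /X => x; case: (sgn); rewrite !inE => /orP[]/eqP->; split.
  - rewrite /X /xvirt => x; case: (sgn); rewrite !inE => /orP[]/eqP-> /=;
    apply/negbTE; rewrite // -?e1 -?e2 //.
  - rewrite /X => x; case: (sgn) over1 over2 over1' over2' => o1 o2 o3 o4;
      by rewrite !inE => /orP[]/eqP->.
  - rewrite /X => x; case: (sgn); rewrite !inE => /orP[]/eqP-> //= _;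
      rewrite ?[sdet D (S true) _ _ _]sdet_antisym ?opprK ?oppr_gt0 //.
  - move=> [k s] [k' s'] /= s01 s'01 n e.
    have sim k0 : simple_strand D (S k0) by case: k0.
    have [kk|kk] := eqVneq k k'.
      by subst k'; exfalso; apply: n; rewrite (sim _ _ _ s01 s'01 e).
    have main u v : 0 <= u <= 1 -> 0 <= v <= 1 ->
        pt D S (false, u) = pt D S (true, v) ->
        exists2 x, x \in X & x.2 = ((false, u), (true, v)) \/
                             x.2 = ((true, v), (false, u)).
      move=> u01 v01 /(meet _ _ u01 v01) [] [-> ->].
        exists (nth ((true, true), ((true, 0), (true, 0))) X 0).
          by rewrite mem_nth // /X; case: (sgn).
        by rewrite /X; case: (sgn); [left|right].
      exists (nth ((true, true), ((true, 0), (true, 0))) X 1).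
        by rewrite mem_nth // /X; case: (sgn).
      by rewrite /X; case: (sgn); [right|left].
    case: k k' kk s01 s'01 e {n} => -[] // _ s01 s'01 e.
      have [x xX xe] := main _ _ s'01 s01 (esym e).
      by exists x => //; case: xe; [right|left].
    exact: main.
have rk : ((pos X (false, s1) = 0%N) * (pos X (false, s2) = 1%N) *
    (pos X (true, t1) = 0%N) * (pos X (true, t2) = 1%N))%type.
  by rewrite /pos /= cf ct /rank /= !ltxx !(lt_facts s12) !(lt_facts t12).
move=> a b; split.
  (* The middle color of a strand is its initial one if it passes over first, and its final one if
     it passes under first; the default of [nth] is the final color, at position 2. *)
  move=> rel; exists (fun k m => nth (b k)
    [:: a k; if sgn (+) k then a k else b k] m).
  split=> [|//|]; last by case; rewrite ?cf ?ct.
  move=> x; rewrite {1}/X; case E : sgn rel => -[h1 h2]; rewrite !inE => /orP[]/eqP->;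
    rewrite /xing_ok /xo /xu /xvirt /xsgn /= !rk /=; split=> //.
  - by apply/act_eq_sym.
  - by apply/act_eq_sym.
move=> [C [Cok Ca Cb]]; rewrite /twist_rel -!Ca -!Cb cf ct /=.
have := Cok (nth ((true, true), ((true, 0), (true, 0))) X 0).
have := Cok (nth ((true, true), ((true, 0), (true, 0))) X 1).
have sX : size X = 2 by rewrite /X; case: (sgn).
rewrite !mem_nth ?sX // {2 4}/X => /(_ isT) + /(_ isT).
case: (sgn); rewrite /xing_ok /xo /xu /xvirt /xsgn /= !rk ?addn0 ?addn1 /=.
  by move=> [e3 e4] [e5 e6]; rewrite e4 e3 e6 e5.
move=> [e3 /act_eq_sym e4] [e5 /act_eq_sym e6].
by rewrite e4 e3 e6 e5.
Qed.

End Configurations.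

Section WinkConfigurations.
Variables (R : realType) (M : one_manifold) (Q : quandle) (D : diagram R M).
Variables (S : bool -> strand R M) (B : set (plane R)).
Hypothesis SB : two_strands_in D B (S false) (S true).

Lemma wink_K_tangle up : wink_K D (S false) (S true) up ->
  tangle D S (@K_rel Q (strand_up (S true)) up).
Proof.
move=> [su [sl [tu [tl [[[su0 sul sl1] [tu0 tul tl1]] [siml simr meet] [d1 d2]
  labels]]]]].
have su1 := lt_trans sul sl1; have sl0 := lt_trans su0 sul.
have tu1 := lt_trans tul tl1; have tl0 := lt_trans tu0 tul.
have su01 := itv01 su0 su1; have sl01 := itv01 sl0 sl1.
have tu01 := itv01 tu0 tu1; have tl01 := itv01 tl0 tl1.
have e1 : pt D S (false, su) = pt D S (true, tu) by apply/meet => //; left.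
have e2 : pt D S (false, sl) = pt D S (true, tl) by apply/meet => //; right.
(* Here r is always listed first, being over at the classical crossing; the sign [true] of the
   virtual crossing is a placeholder. *)
pose X : seq (xing R) := if up
  then [:: ((false, true), ((true, tu), (false, su)));
           ((true, true), ((true, tl), (false, sl)))]
  else [:: ((true, true), ((true, tu), (false, su)));
           ((false, false), ((true, tl), (false, sl)))].
have cf : cuts X false = [:: su; sl] by rewrite /X; case: (up).
have ct : cuts X true = [:: tu; tl] by rewrite /X; case: (up).
have [vu vl] : svirt D (S false) su = ~~ up /\ svirt D (S false) sl = up.
  by move: labels; rewrite /wink_labels; case: (up) => -[/negbTE -> _ ->].
exists X; split.
  split.
  - by case; rewrite ?cf ?ct /= inE ?(lt_facts sul) ?(lt_facts tul).
  - by case=> s; rewrite ?cf ?ct !inE => /orP[]/eqP->; apply/andP.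
  - by rewrite /X => x; case: (up); rewrite !inE => /orP[]/eqP->; split.
  - have vu' : virt D (pt D S (true, tu)) = ~~ up by rewrite -e1.
    have vl' : virt D (pt D S (true, tl)) = up by rewrite -e2.
    by rewrite /X => x; case: (up) vu' vl' => vu' vl';
      rewrite !inE => /orP[]/eqP->.
  - by rewrite /X => x; case: (up) labels => -[_ o _]; rewrite !inE => /orP[]/eqP->.
  - rewrite /X => x; case: (up); rewrite !inE => /orP[]/eqP-> //= _;
      by rewrite [sdet D (S true) _ _ _]sdet_antisym ?opprK ?oppr_gt0.
  - move=> [k s] [k' s'] /= s01 s'01 n e.
    have sim k0 : simple_strand D (S k0) by case: k0.
    have [kk|kk] := eqVneq k k'.
      by subst k'; exfalso; apply: n; rewrite (sim _ _ _ s01 s'01 e).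
    have main u v : 0 <= u <= 1 -> 0 <= v <= 1 ->
        pt D S (false, u) = pt D S (true, v) ->
        exists2 x, x \in X & x.2 = ((true, v), (false, u)).
      move=> u01 v01 /(meet _ _ u01 v01) [] [-> ->].
        exists (nth ((true, true), ((true, 0), (true, 0))) X 0).
          by rewrite mem_nth // /X; case: (up).
        by rewrite /X; case: (up).
      exists (nth ((true, true), ((true, 0), (true, 0))) X 1).
        by rewrite mem_nth // /X; case: (up).
      by rewrite /X; case: (up).
    case: k k' kk s01 s'01 e {n} => -[] // _ s01 s'01 e.
      have [x xX xe] := main _ _ s'01 s01 (esym e).
      by exists x => //; left.
    have [x xX xe] := main _ _ s01 s'01 e.
    by exists x => //; right.
have rk : ((pos X (false, su) = 0%N) * (pos X (false, sl) = 1%N) *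
    (pos X (true, tu) = 0%N) * (pos X (true, tl) = 1%N))%type.
  by rewrite /pos /= cf ct /rank /= !ltxx !(lt_facts sul) !(lt_facts tul).
move=> a b; split.
  move=> rel; exists (fun k m => nth (b k)
    [:: a k; if up (+) k then b k else a k] m).
  split=> [|//|]; last by case; rewrite ?cf ?ct.
  move=> x; rewrite {1}/X; case E : up rel => -[h1 h2]; rewrite !inE => /orP[]/eqP->;
    rewrite /xing_ok /xo /xu /xvirt /xsgn /= !rk ?addn0 ?addn1 /=; split=> //.
  - by rewrite h2 eqb_id.
  - by rewrite h2 h1 eqbF_neg actK.
move=> [C [Cok Ca Cb]]; rewrite /K_rel -!Ca -!Cb cf ct /=.
have := Cok (nth ((true, true), ((true, 0), (true, 0))) X 0).
have := Cok (nth ((true, true), ((true, 0), (true, 0))) X 1).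
have sX : size X = 2 by rewrite /X; case: (up).
rewrite !mem_nth ?sX // {2 4}/X => /(_ isT) + /(_ isT).
case: (up); rewrite /xing_ok /xo /xu /xvirt /xsgn /= !rk ?addn0 ?addn1 /=.
  by move=> [e3 e4] [e5 e6]; rewrite e4 e3 e6 e5 eqb_id.
move=> [e3 /act_eq_sym e4] [e5 e6].
by rewrite e4 e3 e6 e5 eqbF_neg.
Qed.


(** The type of c is not prescribed, so the relation depends on which passage is over. The
    parameters of c are returned with their coincidence, so that for an explicit diagram they can be
    recovered and this boolean evaluated. *)
Lemma wink_cK_tangle up : wink_cK D (S false) (S true) up ->
  exists c1 c2, [/\ 0 <= c1, c1 < c2, c2 <= 1,
    spath D (S false) c1 = spath D (S false) c2
    & tangle D S (@cK_rel Q (sover D (S false) c1) (strand_up (S false))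
        (strand_up (S true)) up)].
Proof.
move=> [c1 [sl [su [c2 [tu [tl [[[c10 c1sl sul suc2 c21] [tu0 tul tl1]]
  [loop simr meet] [dc vc] [d1 d2] labels]]]]]]].
have sl0 := lt_trans c10 c1sl; have su0 := lt_trans sl0 sul.
have su1 := lt_trans suc2 c21; have sl1 := lt_trans sul su1.
have c11 := lt_trans c1sl sl1; have c20 := lt_trans su0 suc2.
have tu1 := lt_trans tul tl1; have tl0 := lt_trans tu0 tul.
have su01 := itv01 su0 su1; have sl01 := itv01 sl0 sl1.
have tu01 := itv01 tu0 tu1; have tl01 := itv01 tl0 tl1.
have c101 := itv01 c10 c11; have c201 := itv01 c20 c21.
have c1su := lt_trans c1sl sul; have slc2 := lt_trans sul suc2.
have c12 := lt_trans c1su suc2.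
have e1 : pt D S (false, su) = pt D S (true, tu) by apply/meet => //; left.
have e2 : pt D S (false, sl) = pt D S (true, tl) by apply/meet => //; right.
have ec : pt D S (false, c1) = pt D S (false, c2).
  by apply/(loop c1 c2) => //; exact: ltW.
have nc : (false, c1) <> (false, c2) by case=> /eqP; rewrite (lt_facts c12).
have vc' : virt D (pt D S (false, c1)) = false by exact/negbTE/vc.
have overc := sover_other SB (p := (false, c1)) (q := (false, c2)) c101 c201 nc ec vc.
pose o := sover D (S false) c1.
pose X : seq (xing R) :=
  (if o then ((false, false), ((false, c1), (false, c2)))
   else ((false, true), ((false, c2), (false, c1)))) ::
  (if up then [:: ((false, false), ((true, tu), (false, su)));
                  ((true, true), ((true, tl), (false, sl)))]
   else [:: ((true, true), ((true, tu), (false, su)));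
            ((false, true), ((true, tl), (false, sl)))]).
(* The order is that of the listing, not of the strand; only ranks and the length will be read
   off. *)
have cf : cuts X false = if o then [:: c1; c2; su; sl] else [:: c2; c1; su; sl].
  by rewrite /X; case: (up); case: (o).
have ct : cuts X true = [:: tu; tl].
  by rewrite /X; case: (up); case: (o).
have [vu vl] : svirt D (S false) su = ~~ up /\ svirt D (S false) sl = up.
  by move: labels; rewrite /wink_labels; case: (up) => -[/negbTE -> _ ->].
pose ltf := (lt_facts c1sl, lt_facts sul, lt_facts suc2, lt_facts tul,
  lt_facts c12, lt_facts c1su, lt_facts slc2).
exists c1, c2; split; [exact: ltW|by []|exact: ltW|exact: ec|].
rewrite -/o; exists X; split.
  split.
  - by case; rewrite ?cf ?ct; [|case: (o)]; rewrite /= !inE !ltf.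
  - case=> s; rewrite ?cf ?ct; first by rewrite !inE => /orP[]/eqP->; apply/andP.
    by case: (o); rewrite !inE => /or4P[]/eqP->; apply/andP.
  - rewrite /X => x; rewrite inE => /predU1P[->|].
      by case: (o); split => // /esym.
    by case: (up); rewrite !inE => /orP[]/eqP->; split.
  - have vu' : virt D (pt D S (true, tu)) = ~~ up by rewrite -e1.
    have vl' : virt D (pt D S (true, tl)) = up by rewrite -e2.
    rewrite /X => x; rewrite inE => /predU1P[->|].
      by case: (o); rewrite /xvirt /xo /= -?ec vc'.
    by case: (up) vu' vl' => vu' vl'; rewrite !inE => /orP[]/eqP->.
  - rewrite /X => x; rewrite inE => /predU1P[->|].
      rewrite /o; case E : (sover D (S false) c1) => //= _.
      by move: overc; rewrite /= E => /esym/negbFE.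
    by case: (up) labels => -[_ ov _]; rewrite !inE => /orP[]/eqP->.
  - rewrite /X => x; rewrite inE => /predU1P[-> _|].
      case: (o) => /=; first by rewrite oppr_gt0.
      by rewrite sdet_antisym oppr_gt0.
    case: (up); rewrite !inE => /orP[]/eqP-> //= _;
      by rewrite [sdet D (S true) _ _ _]sdet_antisym ?opprK ?oppr_gt0.
  - move=> [k s] [k' s'] /= s01 s'01 n e.
    have main u v : 0 <= u <= 1 -> 0 <= v <= 1 ->
        pt D S (false, u) = pt D S (true, v) ->
        exists2 x, x \in X & x.2 = ((true, v), (false, u)).
      move=> u01 v01 /(meet _ _ u01 v01) [] [-> ->].
        exists (nth ((true, true), ((true, 0), (true, 0))) X 1).
          by rewrite mem_nth // /X; case: (up).
        by rewrite /X; case: (up).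
      exists (nth ((true, true), ((true, 0), (true, 0))) X 2).
        by rewrite mem_nth // /X; case: (up).
      by rewrite /X; case: (up).
    have self u v : 0 <= u <= 1 -> 0 <= v <= 1 -> u < v ->
        pt D S (false, u) = pt D S (false, v) ->
        exists2 x, x \in X & x.2 = ((false, u), (false, v)) \/
                             x.2 = ((false, v), (false, u)).
      move=> /andP[u0 _] /andP[_ v1] uv /(loop _ _ u0 uv v1) [-> ->].
      exists (nth ((true, true), ((true, 0), (true, 0))) X 0).
        by rewrite mem_nth.
      by rewrite /X; case: (o); [left|right].
    case: k k' s01 s'01 e n => -[] s01 s'01 e n.
    + by exfalso; apply: n; rewrite (simr _ _ s01 s'01 e).
    + have [x xX xe] := main _ _ s'01 s01 (esym e).
      by exists x => //; left.
    + have [x xX xe] := main _ _ s01 s'01 e.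
      by exists x => //; right.
    have [ss|ss|ss] := ltgtP s s'; last by exfalso; apply: n; rewrite ss.
      exact: self.
    have [x xX xe] := self _ _ s'01 s01 ss (esym e).
    by exists x => //; case: xe; [right|left].
have rk : ((pos X (false, c1) = 0%N) * (pos X (false, sl) = 1%N) *
    (pos X (false, su) = 2%N) * (pos X (false, c2) = 3%N) *
    (pos X (true, tu) = 0%N) * (pos X (true, tl) = 1%N))%type.
  by rewrite /pos /= cf ct /rank; case: (o); rewrite /= !ltxx !ltf.
have sf : size (cuts X false) = 4 by rewrite cf; case: (o).
have okE C : discrete_coloring S X C <->
    [/\ (if o then C false 1 = C false 0 /\
            C false 3 = act (strand_up (S false)) (C false 4) (C false 0)
          else C false 4 = C false 3 /\
            C false 1 = act (strand_up (S false)) (C false 0) (C false 3)),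
        C true 1 = C true 0 /\ C true 2 = C true 1
      & if up then C false 2 = act (strand_up (S true)) (C false 3) (C true 0) /\
                   C false 2 = C false 1
        else C false 3 = C false 2 /\
             C false 2 = act (strand_up (S true)) (C false 1) (C true 1)].
  split=> [Cok|[ok1 [ok2 ok3] ok4] x].
    have sX : size X = 3 by rewrite /X; case: (up).
    have := Cok (nth ((true, true), ((true, 0), (true, 0))) X 0).
    have := Cok (nth ((true, true), ((true, 0), (true, 0))) X 1).
    have := Cok (nth ((true, true), ((true, 0), (true, 0))) X 2).
    rewrite !mem_nth ?sX // {2 4 6}/X => /(_ isT) + /(_ isT) + /(_ isT).
    by case: (o); case: (up); rewrite /xing_ok /xo /xu /xvirt /xsgn /= !rk
      ?addn0 ?addn1 /= => -[? ?] [? ?] [? ?]; split.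
  rewrite {1}/X inE => /predU1P[->|].
    by move: ok1; case: (o); rewrite /xing_ok /xo /xu /xvirt /xsgn /= !rk
      ?addn0 ?addn1.
  by case: (up) ok4 => -[? ?]; rewrite !inE => /orP[]/eqP->;
    rewrite /xing_ok /xo /xu /xvirt /xsgn /= !rk ?addn0 ?addn1.
move=> a b; split.
  move=> rel.
  (* [x1] and [x3] are the colors of l on the loop, before and after its passage under r; the color
     between the lower and the upper point is one of them, depending on which crossing is
     virtual. *)
  pose x1 (first : bool) :=
    if first then a false else act (strand_up (S false)) (a false) (b false).
  pose x3 first := act (strand_up (S true) != up) (x1 first) (a true).
  exists (fun k m => if k then a true else nth (b k)
    [:: a k; x1 o; if up then x1 o else x3 o; x3 o; b k] m).
  split=> [|[]//|]; last by case; rewrite ?sf ?ct //=; case: rel.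
  apply/okE; move: rel; rewrite /cK_rel /x3 /x1.
  by case: (o); case: (up); case: (strand_up (S true)) => /= -[h1 h2];
    split; split=> //; rewrite ?qopK ?qopVK // -?h2 // h2 actK.
move=> [C [/okE [ok1 [ok2 ok3] ok4] Ca Cb]].
rewrite /cK_rel -!Ca -!Cb sf ct /= ok3 ok2; split=> //.
have key : C false 3 = act (strand_up (S true) != up) (C false 1) (C true 0).
  case: (up) ok4 => -[h1 h2]; first by rewrite eqb_id -h2; exact: (act_eq_sym _ _ _ _).1.
  by rewrite eqbF_neg negbK h1 h2 ok2.
case: (o) ok1 => -[h1 h2]; first by rewrite -h1 -key h1; exact: (act_eq_sym _ _ _ _).1.
by rewrite h1 -h2.
Qed.

End WinkConfigurations.

(** * Polynomial diagrams *)

Section UnitDisk.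
Variable R : realType.

Lemma interior_unit_disk (p : plane R) :
  (@unit_disk R)° p <-> p.1 ^+ 2 + p.2 ^+ 2 < 1.
Proof.
split=> [pi|plt]; last first.
  have : \forall q \near p, q.1 ^+ 2 + q.2 ^+ 2 < 1.
    exact: (@sqr_norm_continuous R p _ (lt_nbhsl plt)).
  by apply: filterS => q /ltW.
have p1 : p.1 ^+ 2 + p.2 ^+ 2 <= 1 := interior_subset pi.
rewrite lt_neqAle p1 andbT; apply/eqP => pe.
(* Pushing a point of the circle outwards leaves the disk at once. *)
pose f (h : R) : plane R := ((1 + h) * p.1, (1 + h) * p.2).
have fc : f h @[h --> (0 : R)] --> p.
  have c c0 : (fun h : R => (1 + h) * c0) @ (0 : R) --> c0.
    have : (fun h : R => (1 + h) * c0) @ (0 : R) --> (1 + 0) * c0.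
      by apply: cvgM; [apply: cvgD; [exact: cvg_cst|exact: cvg_id]|exact: cvg_cst].
    by rewrite addr0 mul1r.
  rewrite [X in _ --> X]surjective_pairing.
  exact: (@cvg_pair _ _ _ (nbhs (0 : R)) _ _ _ _ _ _ _ (c p.1) (c p.2)).
have /cvg_at_right_filter fr := fc.
near (0 : R)^'+ => h.
have h0 : 0 < h by near: h; exact: nbhs_right_gt.
have : @unit_disk R (f h) by near: h; exact: (fr _ pi).
rewrite /unit_disk /f /= !exprMn -mulrDr pe mulr1; nra.
Unshelve. all: by end_near. Qed.

Lemma is_disk_unit_disk : is_disk (@unit_disk R).
Proof.
exists id; split; last by rewrite image_id.
  by apply: continuous_subspaceT => p; exact: cvg_id.
by move=> p q.
Qed.

End UnitDisk.

Lemma smooth_horner (R : realType) (p : {poly R}) : smooth (horner p).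
Proof.
move=> n; suff -> : derive1n n (horner p) = horner (p^`(n)).
  by move=> t; exact: derivable_horner.
elim: n => [|n IH]; first by rewrite derivn0.
by rewrite derive1nS IH -derivE derivnS.
Qed.

Definition two_intervals : one_manifold :=
  @OneManifold bool (fun _ => false).

Section PolynomialTangles.
Variable R : realType.

Definition pcurve (px py : bool -> {poly R}) (i : bool) (u : R) : plane R :=
  ((px i).[u], (py i).[u]).

Definition pspeed (px py : bool -> {poly R}) (i : bool) (u : R) : plane R :=
  ((px i)^`().[u], (py i)^`().[u]).

Definition psame (px py : bool -> {poly R}) (p q : bool * R) : Prop :=
  [/\ -1 <= p.2 <= 1, -1 <= q.2 <= 1, p <> q
    & pcurve px py p.1 p.2 = pcurve px py q.1 q.2].

(** Parameters range over [[-1, 1]], so that curves symmetric about the horizontal axis have an even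
    and an odd coordinate. No orientation is recorded: one tangle serves for all four choices of
    [dir]. *)
Record poly_tangle := PolyTangle {
  tx : bool -> {poly R};
  ty : bool -> {poly R};
  tvirt : plane R -> bool;
  tover : bool -> R -> bool;
  t_immersion : forall i u, pspeed tx ty i u <> (0, 0);
  t_inside : forall i u, -1 < u < 1 ->
    (tx i).[u] ^+ 2 + (ty i).[u] ^+ 2 < 1;
  t_ends : forall i u, u = -1 \/ u = 1 ->
    (tx i).[u] ^+ 2 + (ty i).[u] ^+ 2 = 1;
  t_inner : forall p q, psame tx ty p q -> -1 < p.2 < 1;
  t_transverse : forall p q, psame tx ty p q ->
    det (pspeed tx ty p.1 p.2) (pspeed tx ty q.1 q.2) != 0;
  t_no_triple : forall p q r, psame tx ty p q -> psame tx ty p r -> q = r;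
  t_over : forall p q, psame tx ty p q -> ~~ tvirt (pcurve tx ty p.1 p.2) ->
    tover p.1 p.2 = ~~ tover q.1 q.2
}.

(* [dir i] tells whether the orientation of the curve [i] is that of its
   parameter in [-1, 1]. *)
Section Diagram.
Variables (T : poly_tangle) (dir : bool -> bool).

Definition tparam (i : bool) (t : R) : R :=
  if dir i then t *+ 2 - 1 else 1 - t *+ 2.

Definition tparam_poly (i : bool) : {poly R} :=
  if dir i then 'X *+ 2 - 1%:P else 1%:P - 'X *+ 2.

Lemma tparam_polyE i t : (tparam_poly i).[t] = tparam i t.
Proof. by rewrite /tparam_poly /tparam; case: dir; rewrite !hornerE. Qed.

Definition tpath (i : bool) (t : R) : plane R :=
  pcurve (tx T) (ty T) i (tparam i t).

Lemma tpath1E i : (fun t => (tpath i t).1) = horner (tx T i \Po tparam_poly i).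
Proof. by apply/funext => t; rewrite horner_comp tparam_polyE. Qed.

Lemma tpath2E i : (fun t => (tpath i t).2) = horner (ty T i \Po tparam_poly i).
Proof. by apply/funext => t; rewrite horner_comp tparam_polyE. Qed.

Lemma tpath_velocity i t : let c := if dir i then 2 else - 2 in
  velocity (tpath i) t =
    (c * (pspeed (tx T) (ty T) i (tparam i t)).1,
     c * (pspeed (tx T) (ty T) i (tparam i t)).2).
Proof.
have dE : (tparam_poly i)^`() = (if dir i then 2 else - 2)%:P.
  rewrite /tparam_poly; case: dir;
    rewrite derivB derivMn derivX derivC ?subr0 ?sub0r ?polyCN;
    by rewrite -polyC_natr.
rewrite /velocity tpath1E tpath2E -!derivE !deriv_comp !hornerM !horner_comp.
by rewrite !tparam_polyE dE !hornerC ![_ * (if _ then _ else _)]mulrC.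
Qed.

Lemma tparam_in i t : 0 <= t <= 1 -> -1 <= tparam i t <= 1.
Proof. by rewrite /tparam; case: dir => t01; lra. Qed.

Lemma tparam_inner i t : -1 < tparam i t < 1 <-> 0 < t < 1.
Proof. by rewrite /tparam; case: dir; split; lra. Qed.

Lemma tparam_inj i s t : tparam i s = tparam i t -> s = t.
Proof. by rewrite /tparam; case: dir; lra. Qed.

Lemma tdouble i s j t : @double_pt R two_intervals tpath i s j t ->
  psame (tx T) (ty T) (i, tparam i s) (j, tparam j t).
Proof.
case=> -[//|s01] [//|t01] n e; split; [exact: tparam_in|exact: tparam_in| |by []].
by case=> ij st; apply: n; subst j; split => //; left; exact: tparam_inj st.
Qed.

Definition poly_diagram : diagram R two_intervals.
Proof.
refine (@Diagram R two_intervals tpath (tvirt T)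
  (fun i t => tover T i (tparam i t)) _ _ _ _ _ _ _ _ _).
- by [].
- by move=> i; rewrite tpath1E tpath2E; split; exact: smooth_horner.
- move=> i t _; rewrite tpath_velocity => -[e1 e2].
  apply: (@t_immersion T i (tparam i t)).
  have c0 : (if dir i then 2 else - 2) != 0 :> R.
    by case: dir; rewrite ?oppr_eq0 pnatr_eq0.
  move/eqP: e1; move/eqP: e2; rewrite !mulf_eq0 (negbTE c0) /=.
  by move=> /eqP e2 /eqP e1; congr (_, _).
- move=> i t [//|/(tparam_in i) t01]; rewrite /unit_disk /=.
  have [/t_inside|n] := boolP (-1 < tparam i t < 1); first by move=> /(_ T i)/ltW.
  rewrite t_ends //; move: n t01; rewrite negb_and -!leNgt => /orP[] ? ?.
    by left; lra.
  by right; lra.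
- move=> i _; split; apply: t_ends; rewrite /tparam; case: dir; rewrite ?mul0rn.
  + by left; rewrite sub0r.
  + by right; rewrite subr0.
  + by right; lra.
  + by left; lra.
- by move=> i s j t /tdouble/t_inner /= /tparam_inner; right.
- move=> i s j t /tdouble/t_transverse /=; rewrite !tpath_velocity /det /=.
  move=> d0; set c := (if dir i then _ else _); set c' := (if dir j then _ else _).
  have cc0 : c * c' != 0.
    by rewrite mulf_neq0 // /c /c'; case: dir; rewrite ?oppr_eq0 pnatr_eq0.
  by apply: contra_neq (mulf_neq0 cc0 d0) => H; rewrite -[RHS]H; ring.
- move=> i s j t k u /tdouble H1 /tdouble H2.
  by have [jk tu] := t_no_triple H1 H2; subst k; split => //; left;
    exact: tparam_inj tu.
- by move=> i s j t /tdouble/t_over.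
Defined.

(** Traversed along increasing parameter in [[-1, 1]] for either value of [dir]: changing the
    orientation changes [strand_up] but not the configuration. *)
Definition tstrand (k : bool) : strand R two_intervals :=
  @Strand R two_intervals k (if dir k then 0 else 1) (if dir k then 1 else 0).

Lemma tstrand_up k : strand_up (tstrand k) = dir k.
Proof. by rewrite /strand_up /=; case: dir; rewrite ?ltr01 ?ltr10. Qed.

Lemma tparam_tstrand k s : tparam k (sparam (tstrand k) s) = s *+ 2 - 1.
Proof. by rewrite /tparam /sparam /=; case: dir; ring. Qed.

Lemma spath_tstrand k s :
  spath poly_diagram (tstrand k) s = pcurve (tx T) (ty T) k (s *+ 2 - 1).
Proof. by rewrite /spath /= /tpath tparam_tstrand. Qed.

Lemma sover_tstrand k s :
  sover poly_diagram (tstrand k) s = tover T k (s *+ 2 - 1).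
Proof. by rewrite /sover /= tparam_tstrand. Qed.

Lemma svirt_tstrand k s : svirt poly_diagram (tstrand k) s =
  tvirt T (pcurve (tx T) (ty T) k (s *+ 2 - 1)).
Proof. by rewrite /svirt spath_tstrand. Qed.

Lemma sdet_tstrand k s k' s' :
  sdet poly_diagram (tstrand k) s (tstrand k') s' =
  4 * det (pspeed (tx T) (ty T) k (s *+ 2 - 1))
          (pspeed (tx T) (ty T) k' (s' *+ 2 - 1)).
Proof.
have vE k0 t : velocity (path poly_diagram (scomp (tstrand k0))) t = _ :=
  tpath_velocity k0 t.
rewrite /sdet /svel !vE /= !tparam_tstrand /det /=.
by case: (dir k); case: (dir k'); ring.
Qed.

Lemma tstrand_valid k : valid_strand (tstrand k).
Proof.
by rewrite /valid_strand /=; case: dir; split; rewrite ?lexx ?ler01 //; lra.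
Qed.

Lemma tstrand_two_strands :
  two_strands_in poly_diagram (@unit_disk R) (tstrand false) (tstrand true).
Proof.
have int k s : 0 <= s <= 1 ->
    ((@unit_disk R)° (spath poly_diagram (tstrand k) s) <-> 0 < s < 1).
  move=> s01; rewrite interior_unit_disk spath_tstrand /=; split=> [|s01'].
    move=> lt1; apply/negP => /negP n.
    have : s *+ 2 - 1 = -1 \/ s *+ 2 - 1 = 1.
      move: n; rewrite negb_and -!leNgt => /orP[] ?; [left|right]; lra.
    by move/(t_ends T k) => e; rewrite e ltxx in lt1.
  by apply: t_inside; lra.
have on k t : 0 <= t <= 1 -> on_strand (tstrand k) k t.
  move=> t01; exists (if dir k then t else 1 - t).
    by case: dir; lra.
  by split=> //; left; rewrite /sparam /=; case: dir; ring.
split; [by split; exact: tstrand_valid| | |exact: int|exact: int].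
  by move=> i t [[s _ [-> _]] [s' _ [e _]]].
move=> i t it; split=> _; last exact: diag_in_disk it.
by case: it => // t01; case: i; [right|left]; exact: on.
Qed.

End Diagram.

(** The diagrams fill the unit disk and all crossings are interior, so agreement outside reduces to
    the four ends. *)
Lemma poly_local_change (T T' : poly_tangle) dir :
  (forall i u, u = -1 \/ u = 1 ->
    pcurve (tx T) (ty T) i u = pcurve (tx T') (ty T') i u) ->
  local_change (poly_diagram T dir) (poly_diagram T' dir) (@unit_disk R)
    (tstrand dir false) (tstrand dir true).
Proof.
move=> e; split; [by split; [exact: is_disk_unit_disk|]| |
  exact: tstrand_two_strands|exact: tstrand_two_strands].
have bd (T0 : poly_tangle) i t : in_dom (M := two_intervals) i t ->
    ~ (@unit_disk R)° (path (poly_diagram T0 dir) i t) ->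
    tparam dir i t = -1 \/ tparam dir i t = 1.
  move=> [//|/(tparam_in dir i) t01] n; apply: contrapT => n'; apply: n.
  apply/interior_unit_disk; apply: t_inside.
  move: t01 => /andP[t0 t1]; rewrite !lt_neqAle t0 t1 !andbT.
  by apply/andP; split; apply/eqP => e'; apply: n'; [left|right].
split.
  by move=> i t it [] /(bd _ _ _ it); exact: e.
move=> i s j t x n; exfalso; apply: n.
have := t_inner (tdouble x) => /= ?; apply/interior_unit_disk.
exact: t_inside.
Qed.

End PolynomialTangles.

(** * Explicit curves for the full twists, K and cK *)

Section Examples.
Variable R : realType.
Implicit Types (a b c d u v : R).

Definition even_quadratic a b : {poly R} := a *: 'X^2 + b%:P.
Definition odd_cubic c d : {poly R} := c *: 'X^3 + d *: 'X.

Lemma even_quadraticE a b u : (even_quadratic a b).[u] = a * u ^+ 2 + b.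
Proof. by rewrite !hornerE. Qed.

Lemma odd_cubicE c d u : (odd_cubic c d).[u] = c * u ^+ 3 + d * u.
Proof. by rewrite !hornerE. Qed.

Lemma even_quadratic_deriv a b u : (even_quadratic a b)^`().[u] = 2 * a * u.
Proof.
rewrite /even_quadratic derivD derivZ derivXn derivC !hornerE /=. ring.
Qed.

Lemma odd_cubic_deriv c d u : (odd_cubic c d)^`().[u] = 3 * c * u ^+ 2 + d.
Proof.
rewrite /odd_cubic derivD !derivZ derivXn derivX !hornerE /=. ring.
Qed.

Definition polyE := (even_quadraticE, odd_cubicE, even_quadratic_deriv,
  odd_cubic_deriv).

Lemma sqr_eq_half u : u ^+ 2 = 4^-1 -> u = - 2^-1 \/ u = 2^-1.
Proof.
move=> e; have : (u + 2^-1) * (u - 2^-1) = 0 by nra.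
by move/eqP; rewrite mulf_eq0 addr_eq0 subr_eq0 => /orP[]/eqP; [left|right].
Qed.

Section Twist.
Variable sgn : bool.

(** Two parabolic arcs bulging to abscissa 1/5 and -1/5. The 3-4-5 triangle provides rational ends
    on the circle, and both abscissas vanish at parameters 1/2 and -1/2. *)
Definition twist_x (i : bool) : {poly R} :=
  if i then even_quadratic (4 / 5) (- (1 / 5))
  else even_quadratic (- (4 / 5)) (1 / 5).
Definition twist_y (i : bool) : {poly R} := odd_cubic 0 (4 / 5).

Lemma twist_same i u j v : psame twist_x twist_y (i, u) (j, v) ->
  [/\ j = ~~ i, v = u & u = - 2^-1 \/ u = 2^-1].
Proof.
case=> /= _ _ n []; rewrite !polyE => ex ey.
have uv : v = u by lra.
subst v; have ij : j = ~~ i by case: i j n {ex ey} => -[].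
by split => //; apply: sqr_eq_half; subst j; move: ex; case: i {n};
  rewrite /= !polyE; lra.
Qed.

(** For [sgn] true, the left strand is over at the lower point and the right strand at the upper
    one. *)
Definition twist_over (i : bool) u : bool := (i (+) (u < 0)) (+) ~~ sgn.

Definition twist_tangle : poly_tangle R.
Proof.
refine (@PolyTangle R twist_x twist_y (fun=> false) twist_over _ _ _ _ _ _ _).
- move=> i u; rewrite /pspeed /twist_y polyE => -[_]; lra.
- move=> i u u1.
  have w1 : u ^+ 2 < 1 by nra.
  have w0 : 0 <= u ^+ 2 by exact: sqr_ge0.
  by rewrite /twist_y; case: i; rewrite /= !polyE; move: (u ^+ 2) w0 w1 => w; nra.
- by move=> i u [] ->; rewrite /twist_y; case: i; rewrite /= !polyE; field.
- by move=> [i u] [j v] /twist_same [_ _ [] ->] /=; lra.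
- move=> [i u] [j v] /twist_same [-> -> h] /=; apply/eqP.
  rewrite /det /pspeed /twist_y /=.
  by case: i; rewrite /= !polyE; case: h => ->; lra.
- by move=> [i u] [j v] [k w] /twist_same [-> -> _] /twist_same [-> -> _].
- by move=> [i u] [j v] /twist_same [-> -> _] /= _; rewrite /twist_over !addNb negbK.
Defined.

End Twist.

(** The lower meeting of l and r is virtual, the upper one classical ([up = true]), and c, at height
    0, classical. *)
Definition wink_virt (p : plane R) : bool := p.2 < 0.

(* All curves end at the points (+-3/5, +-4/5) or (0, +-1). Both versions of [l]
   meet [r] at the parameters +-1/2, where [wink_x false] vanishes, and [l]
   crosses itself in [cK] at the nonzero roots +-3/5 of [cK_y false]. *)
Definition wink_x (i : bool) : {poly R} :=
  if i then even_quadratic 0 0 else even_quadratic (- (4 / 5)) (1 / 5).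
Definition K_y (i : bool) : {poly R} :=
  if i then odd_cubic 0 (-1) else odd_cubic 0 (- (4 / 5)).
(** The coefficients are determined by the value -4/5 at 1 and the root 3/5. As 3/5 exceeds 1/2, l
    meets r between its two passages through c. *)
Definition cK_y (i : bool) : {poly R} :=
  if i then odd_cubic 0 (-1) else odd_cubic (- (5 / 4)) (9 / 20).

Lemma K_same i u j v : psame wink_x K_y (i, u) (j, v) ->
  [/\ j = ~~ i, v = (if i then 5 / 4 else 4 / 5) * u
    & (if i then v else u) = - 2^-1 \/ (if i then v else u) = 2^-1].
Proof.
case=> /= _ _ n [].
case: i j n => -[] n; rewrite /= !polyE => ex ey.
- by exfalso; apply: n; congr (_, _); lra.
- by split; [| lra |apply: sqr_eq_half; lra].
- by split; [| lra |apply: sqr_eq_half; lra].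
- by exfalso; apply: n; congr (_, _); lra.
Qed.

Definition K_tangle : poly_tangle R.
Proof.
refine (@PolyTangle R wink_x K_y wink_virt (fun i _ => i) _ _ _ _ _ _ _).
- move=> i u; rewrite /pspeed; case: i; rewrite /= !polyE => -[_]; lra.
- move=> i u u1.
  have w1 : u ^+ 2 < 1 by nra.
  have w0 : 0 <= u ^+ 2 by exact: sqr_ge0.
  by case: i; rewrite /= !polyE; move: (u ^+ 2) w0 w1 (expr2 u) => w; nra.
- by move=> i u [] ->; case: i; rewrite /= !polyE; field.
- by move=> [[] u] [j v] /K_same [_ /= ? []] /=; lra.
- move=> [i u] [j v] /K_same [-> -> h] /=; apply/eqP.
  move: h; rewrite /det /pspeed /=.
  by case: i; rewrite /= !polyE => -[]; nra.
- move=> [i u] [j v] [k w] /K_same [-> -> _] /K_same [-> -> _] //.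
- by move=> [i u] [j v] /K_same [-> _ _] /= _; rewrite negbK.
Defined.

(** At a self-crossing, the even abscissa gives [v = - u] and the odd ordinate must then vanish.
    When the square of the parameter is 1/4, the ordinate of l is 11/80 times the parameter. *)
Lemma cK_same i u j v : psame wink_x cK_y (i, u) (j, v) ->
  if i then [/\ j = false, u = - (11 / 80) * v & v = - 2^-1 \/ v = 2^-1]
  else if j then v = - (11 / 80) * u /\ (u = - 2^-1 \/ u = 2^-1)
  else v = - u /\ (u = - (3 / 5) \/ u = 3 / 5).
Proof.
case=> /= _ _ n [].
case: i j n => -[] n; rewrite /= !polyE => ex ey.
- by exfalso; apply: n; congr (_, _); lra.
- have h : v = - 2^-1 \/ v = 2^-1 by apply: sqr_eq_half; lra.
  by split=> //; case: h ey => ->; lra.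
- have h : u = - 2^-1 \/ u = 2^-1 by apply: sqr_eq_half; lra.
  by split=> //; case: h ey => ->; lra.
have uv : v = - u.
  have : (v + u) * (v - u) = 0 by nra.
  move/eqP; rewrite mulf_eq0 addr_eq0 subr_eq0 => /orP[]/eqP// vu.
  by exfalso; apply: n; rewrite vu.
subst v; split=> //.
have : u * ((u + 3 / 5) * (u - 3 / 5)) = 0 by move: ey; rewrite !exprS expr0; nra.
move/eqP; rewrite !mulf_eq0 addr_eq0 subr_eq0 => /or3P[]/eqP u0; last by right.
  by exfalso; apply: n; rewrite u0 oppr0.
by left.
Qed.

(** Here [w] is the squared parameter. The ends lie on the circle, so [1 - w] divides the
    difference, and the cofactor has positive coefficients. *)
Lemma cK_inside (w : R) : 0 <= w < 1 ->
  (- (4 / 5) * w + 1 / 5) ^+ 2 + w * (- (5 / 4) * w + 9 / 20) ^+ 2 < 1.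
Proof.
move=> /andP[w0 w1]; rewrite -subr_gt0.
have -> : 1 - ((- (4 / 5) * w + 1 / 5) ^+ 2 +
    w * (- (5 / 4) * w + 9 / 20) ^+ 2) =
  (1 - w) * (16 / 25 * (w + 1 / 2) +
    25 / 16 * (w ^+ 2 + 7 / 25 * w + 256 / 625)) by field.
by apply: mulr_gt0; nra.
Qed.

Definition cK_tangle : poly_tangle R.
Proof.
(* At c, the first passage of l is over, which makes the relation of cK explicit. At parameter -1/2
   of l both strands are marked over, but that crossing is virtual. *)
refine (@PolyTangle R wink_x cK_y wink_virt (fun i u => i || (u < 0))
  _ _ _ _ _ _ _).
- move=> i u; rewrite /pspeed; case: i; rewrite /= !polyE => -[e1 e2]; first lra.
  have u0 : u = 0 by lra.
  by move: e2; rewrite u0; lra.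
- move=> i u u1.
  have w1 : u ^+ 2 < 1 by nra.
  have w0 : 0 <= u ^+ 2 by exact: sqr_ge0.
  case: i; rewrite /= !polyE; first by nra.
  have := @cK_inside (u ^+ 2); rewrite w0 w1 => /(_ isT).
  by congr (_ < _); ring.
- by move=> i u [] ->; case: i; rewrite /= !polyE; field.
- by move=> [[] u] [[] v] /cK_same /= => [[] //|[_ -> []]|[_ []]|[_ []]] ->; lra.
- move=> [[] u] [[] v] /cK_same /= => [[] //|[_ -> h]|[-> h]|[-> h]]; apply/eqP;
    rewrite /det /pspeed /= !polyE; case: h => ->; lra.
- move=> [[] u] [[] v] [[] w] /cK_same /= H /cK_same /= H'.
  all: try by case: H.
  all: try by case: H'.
  + by case: H H' => _ e1 _ [_ e2 _]; congr (_, _); lra.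
  + by case: H H' => -> _ [-> _].
  + by exfalso; case: H H' => _ h [_ h']; case: h h' => -> []; lra.
  + by exfalso; case: H H' => _ h [_ h']; case: h h' => -> []; lra.
  + by case: H H' => -> _ [-> _].
- move=> [[] u] [[] v] /cK_same /= => [[] //|[_ -> h]|[_ h]|[-> h]];
    rewrite /wink_virt /= ?polyE.
  + case: h => -> n /=; last by apply/esym; rewrite -leNgt; apply/idP; lra.
    by exfalso; move/negP: n; apply; lra.
  + case: h => -> n /=; last by apply/negbTE; rewrite -leNgt; lra.
    by exfalso; move/negP: n; apply; lra.
  + by case: h => -> _; rewrite ?oppr_lt0 ?oppr_gt0 ?opprK; [rewrite -leNgt|]; lra.
Defined.

End Examples.

(** * Moves between polynomial diagrams *)

Section ExampleMoves.
Variable R : realType.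

Lemma spath_eq (T : poly_tangle R) dir k s k' s' :
  0 <= s <= 1 -> 0 <= s' <= 1 ->
  spath (poly_diagram T dir) (tstrand R dir k) s =
    spath (poly_diagram T dir) (tstrand R dir k') s' ->
  (k, s) = (k', s') \/
    psame (tx T) (ty T) (k, s *+ 2 - 1) (k', s' *+ 2 - 1).
Proof.
move=> s01 s'01; rewrite !spath_tstrand => e.
have [->|n] := pselect ((k, s) = (k', s')); [by left|right].
split=> //=; [lra|lra|]; case=> kk ss; apply: n; congr (_, _) => //; lra.
Qed.

Lemma wink_virt_pcurve px py i (u : R) :
  wink_virt (pcurve px py i u) = ((py i).[u] < 0).
Proof. by []. Qed.

Lemma twist_diagram_full_twist sgn dir :
  full_twist (poly_diagram (twist_tangle R sgn) dir)
    (tstrand R dir false) (tstrand R dir true) sgn.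
Proof.
(* A curve parameter [u] corresponds to the strand parameter [(u + 1) / 2]. *)
have u1 : (1 / 4 : R) *+ 2 - 1 = - 2^-1 by field.
have u2 : (3 / 4 : R) *+ 2 - 1 = 2^-1 by field.
have simple k : simple_strand (poly_diagram (twist_tangle R sgn) dir) (tstrand R dir k).
  move=> s s' s01 s'01 /(spath_eq s01 s'01)[[]//|/twist_same[]].
  by case: k.
have d1 : 0 < sdet (poly_diagram (twist_tangle R sgn) dir) (tstrand R dir false) (1 / 4)
    (tstrand R dir true) (1 / 4).
  by rewrite sdet_tstrand u1 /det /pspeed /= /twist_y !polyE; lra.
have d2 : sdet (poly_diagram (twist_tangle R sgn) dir) (tstrand R dir false) (3 / 4)
    (tstrand R dir true) (3 / 4) < 0.
  by rewrite sdet_tstrand u2 /det /pspeed /= /twist_y !polyE; lra.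
exists (1 / 4), (3 / 4), (1 / 4), (3 / 4); split; [by split; split; lra| |by []|by []|].
  split => // s t s01 t01; split.
    move=> /(spath_eq s01 t01)[[]//|/twist_same[_ e1 e2]].
    by case: e2 => e2; [left|right]; lra.
  by case=> -[-> ->]; rewrite !spath_tstrand ?u1 ?u2 /pcurve /= /twist_y !polyE;
    congr (_, _); field.
rewrite /positive_half_twist !sover_tstrand u1 u2 /= /twist_over.
rewrite ![sdet _ (tstrand R dir true) _ _ _]sdet_antisym !oppr_gt0.
rewrite oppr_lt0 invr_gt0 ltr0n /= [2^-1 < 0]ltNge invr_ge0 ler0n /=.
by case: (sgn); rewrite /= ?d1 ?d2 ?(lt_gtF d1) ?(lt_gtF d2).
Qed.

Lemma K_diagram_wink_K dir :
  wink_K (poly_diagram (K_tangle R) dir)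
    (tstrand R dir false) (tstrand R dir true) true.
Proof.
have u1 : (1 / 4 : R) *+ 2 - 1 = - 2^-1 by field.
have u2 : (3 / 4 : R) *+ 2 - 1 = 2^-1 by field.
(* On r the ordinate is minus the parameter, and l meets it at heights 2/5 and -2/5. *)
have v1 : (3 / 10 : R) *+ 2 - 1 = - (2 / 5) by field.
have v2 : (7 / 10 : R) *+ 2 - 1 = 2 / 5 by field.
have simple k : simple_strand (poly_diagram (K_tangle R) dir) (tstrand R dir k).
  by move=> s s' s01 s'01 /(spath_eq s01 s'01)[[]//|/K_same[]]; case: k.
exists (1 / 4), (3 / 4), (3 / 10), (7 / 10); split.
- by split; split; lra.
- split => // s t s01 t01; split.
    move=> /(spath_eq s01 t01)[[]//|/K_same[_ /= e1 e2]].
    by case: e2 => e2; [left|right]; lra.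
  by case=> -[-> ->]; rewrite !spath_tstrand ?u1 ?u2 ?v1 ?v2 /pcurve /= !polyE;
    congr (_, _); field.
- rewrite !sdet_tstrand u1 u2 v1 v2 /det /pspeed /= !polyE; split; lra.
- rewrite /wink_labels !svirt_tstrand sover_tstrand u1 u2 /= !wink_virt_pcurve /= !polyE.
  by split => //; rewrite -?leNgt; lra.
Qed.

Lemma cK_diagram_wink_cK dir :
  wink_cK (poly_diagram (cK_tangle R) dir)
    (tstrand R dir false) (tstrand R dir true) true.
Proof.
have u1 : (1 / 4 : R) *+ 2 - 1 = - 2^-1 by field.
have u2 : (3 / 4 : R) *+ 2 - 1 = 2^-1 by field.
have w1 : (1 / 5 : R) *+ 2 - 1 = - (3 / 5) by field.
have w2 : (4 / 5 : R) *+ 2 - 1 = 3 / 5 by field.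
(* The loop meets r at heights 11/160 and -11/160. *)
have v1 : (149 / 320 : R) *+ 2 - 1 = - (11 / 160) by field.
have v2 : (171 / 320 : R) *+ 2 - 1 = 11 / 160 by field.
exists (1 / 5), (1 / 4), (3 / 4), (4 / 5), (149 / 320), (171 / 320); split.
- by split; split; lra.
- split.
  + move=> s s' s0 ss s1; split.
      have s01 : 0 <= s <= 1 by lra.
      have s'01 : 0 <= s' <= 1 by lra.
      move=> /(spath_eq s01 s'01)[[e]|/cK_same /= [e1 e2]]; first by lra.
      by case: e2; lra.
    by case=> -> ->; rewrite !spath_tstrand w1 w2 /pcurve /= !polyE;
      congr (_, _); field.
  + by move=> s s' s01 s'01 /(spath_eq s01 s'01)[[]//|/cK_same /= []].
  + move=> s t s01 t01; split.
      move=> /(spath_eq s01 t01)[[]//|/cK_same[/= e1 e2]].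
      by case: e2 => e2; [right|left]; lra.
    by case=> -[-> ->]; rewrite !spath_tstrand ?u1 ?u2 ?v1 ?v2 /pcurve /= !polyE;
      congr (_, _); field.
- rewrite sdet_tstrand svirt_tstrand w1 w2 /= wink_virt_pcurve /det /pspeed /= !polyE.
  by rewrite -leNgt; split; lra.
- rewrite !sdet_tstrand u1 u2 v1 v2 /det /pspeed /= !polyE; split; lra.
- rewrite /wink_labels !svirt_tstrand sover_tstrand u1 u2 /= !wink_virt_pcurve /= !polyE.
  by split => //; rewrite -?leNgt; lra.
Qed.

End ExampleMoves.

(** * The two equivalences with 4-coherence *)

Section MainTheorem.
Variables (R : realType) (Q : quandle).

Definition strand_pair (M : one_manifold) (S1 S2 : strand R M) (k : bool) :=
  if k then S2 else S1.

Lemma coherent4_four_move : coherent4 Q ->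
  @colorings_extend R Q (@four_move R).
Proof.
move=> H M D D' B [S1 [S2 [sgn [lc ft ft']]]] col colD.
pose S := strand_pair S1 S2.
have [_ _ SB SB'] := lc.
have t1 := full_twist_tangle Q (S := S) SB ft.
have t2 := full_twist_tangle Q (S := S) SB' ft'.
apply: (tangle_extend (S := S) lc colD t2); apply: twist_rel_flip => //.
exact: tangle_coloring SB t1 colD.
Qed.

Lemma coherent4_wink_move : coherent4 Q ->
  @colorings_extend R Q (@wink_move R).
Proof.
move=> H M D D' B [l [r [up [lc ]]]] wk col colD.
pose S := strand_pair l r.
have [_ _ SB SB'] := lc.
case: wk => -[w1 w2].
  have [c1 [c2 [_ _ _ _ t1]]] := wink_cK_tangle Q (S := S) SB w1.
  have t2 := wink_K_tangle Q (S := S) w2.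
  apply: (tangle_extend (S := S) lc colD t2).
  by apply/(cK_rel_K_rel _ _ _ _ _ _ H); exact: tangle_coloring SB t1 colD.
have t1 := wink_K_tangle Q (S := S) w1.
have [c1 [c2 [_ _ _ _ t2]]] := wink_cK_tangle Q (S := S) SB' w2.
apply: (tangle_extend (S := S) lc colD t2).
by apply/(cK_rel_K_rel _ _ _ _ _ _ H); exact: tangle_coloring SB t1 colD.
Qed.

Lemma coherent4_of_act : (forall e (x y : Q),
  act e (act true x y) x = act false x y) -> coherent4 Q.
Proof.
move=> H x y; split; last exact: (H false x y).
exact: etrans (H true x y) (esym (H false x y)).
Qed.

Lemma four_move_coherent4 : @colorings_extend R Q (@four_move R) ->
  coherent4 Q.
Proof.
move=> ext; apply: coherent4_of_act => e x y.
(* The final color of the left strand is [act true x (act e y x)] for sigma^2 and [act false x y]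
   for sigma^-2; [act_act_l] turns the first into [act e (act true x y) x]. *)
pose dir k := if k then true else e.
pose D sgn := poly_diagram (twist_tangle R sgn) dir.
pose S := tstrand R dir.
have lc : local_change (D true) (D false) (@unit_disk R) (S false) (S true).
  exact: poly_local_change.
have ft sgn := twist_diagram_full_twist R sgn dir.
have [_ _ SB SB'] := lc.
have t1 := full_twist_tangle Q (S := S) SB (ft true).
have t2 := full_twist_tangle Q (S := S) SB' (ft false).
have extD := ext _ (D true) (D false) (@unit_disk R)
  (ex_intro _ _ (ex_intro _ _ (ex_intro _ true (And3 lc (ft true) (ft false))))).
pose a k := if k then y else x.
pose b k := if k then act e y x else act true x (act e y x).
have := extension_rel lc (fun i t => @diag_in_disk _ _ (D true) i t) t1 t2 extD
  (a := a) (b := b).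
rewrite !tstrand_up /= => -[] //.
by rewrite -/(act true x _) act_act_l.
Qed.

Lemma wink_move_coherent4 : @colorings_extend R Q (@wink_move R) ->
  coherent4 Q.
Proof.
move=> ext; apply: coherent4_of_act => e x y.
(* With r against its traversal and [up = true], r acts by [act false] in K and by [act true] in cK;
   the direction [~~ e] of l makes c act by [act e]. *)
pose dir k := if k then false else ~~ e.
pose D := poly_diagram (K_tangle R) dir.
pose D' := poly_diagram (cK_tangle R) dir.
pose S := tstrand R dir.
have lc : local_change D D' (@unit_disk R) (S false) (S true).
  apply: poly_local_change => i u ue; rewrite /pcurve /=; congr (_, _).
  by case: i; case: ue => ->; rewrite /= !polyE; field.
have w1 := K_diagram_wink_K R dir; have w2 := cK_diagram_wink_cK R dir.
have [_ _ SB SB'] := lc.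
have t1 := wink_K_tangle Q (S := S) w1.
have [c1 [c2 [c10 c12 c21 ce t2]]] := wink_cK_tangle Q (S := S) SB' w2.
have o : sover D' (S false) c1.
  rewrite sover_tstrand /=.
  have c101 : 0 <= c1 <= 1 by lra.
  have c201 : 0 <= c2 <= 1 by lra.
  have [[]|/cK_same /= [e1 []]] := spath_eq c101 c201 ce; lra.
rewrite o in t2.
have extD := ext _ D D' (@unit_disk R)
  (ex_intro _ _ (ex_intro _ _ (ex_intro _ true (conj lc (or_intror (conj w1 w2)))))).
pose a k := if k then y else x.
pose b k := if k then y else act false x y.
have := extension_rel lc (fun i t => @diag_in_disk _ _ D i t) t1 t2 extD
  (a := a) (b := b).
by rewrite /cK_rel !tstrand_up /= negbK => -[].
Qed.

End MainTheorem.

Theorem mainTheorem4 (R : realType) (Q : quandle) :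
  [/\ coherent4 Q <-> @colorings_extend R Q (@four_move R),
      coherent4 Q <-> @colorings_extend R Q (@wink_move R)
    & @colorings_extend R Q (@four_move R) <->
      @colorings_extend R Q (@wink_move R)].
Proof.
have four : coherent4 Q <-> @colorings_extend R Q (@four_move R).
  by split; [exact: coherent4_four_move|exact: four_move_coherent4].
have wink : coherent4 Q <-> @colorings_extend R Q (@wink_move R).
  by split; [exact: coherent4_wink_move|exact: wink_move_coherent4].
by split=> //; rewrite -four.
Qed.
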